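(* Consider the one-way random effects model $Y_{ij}=\mu+b_i+e_{ij}$, $i=1,\ldots,k$, $j=1,\ldots,n_i$, with $\mathbb{E}[e_{ij}^4]<\infty$, and let $J_n=\binom{n}{2}B_n/(W_n\sqrt{M_n})$, where $n=\sum_{i=1}^k n_i$. Suppose the treatment sizes are bounded, i.e. there is a constant $N$ with $2\le n_i\le N$ for all $i$ and all $k$, and let $\lambda=\lim_{n\to\infty}M_n/n^3$ (assumed to exist; it is finite because $M_n=O(n^3)$). Assume that the fourth moment of the distribution of the random effects $b_i$ is finite, and let $\delta$ denote a constant. Then, under the sequence of local hypotheses $\mathcal{H}_{1n}:\sigma_b^2=\delta^2/\sqrt{n}$, $$J_n\xrightarrow{D}\mathcal{N}\left(\frac{\delta^2}{2\sigma_e^2\sqrt{\lambda}},\,1\right)\quad\text{as } k\to\infty.$$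
   Context: Model: $Y_{ij}=\mu+b_i+e_{ij}$ for $i=1,\ldots,k$, $j=1,\ldots,n_i$ with $n_i\ge 2$, where $\mu\in\mathbb{R}$, all the random variables $b_i$ and $e_{ij}$ are mutually independent, the $b_i$ are identically distributed with mean $0$ and variance $\sigma_b^2\ge 0$, and the $e_{ij}$ are identically distributed with mean $0$ and variance $\sigma_e^2>0$. Put $n=\sum_{i=1}^k n_i$. Under $\mathcal{H}_{1n}$ the variance of the $b_i$ is $\sigma_b^2=\delta^2/\sqrt n$, while the distribution of the $e_{ij}$ does not depend on $n$. Define the within-treatment $U$-statistics $$U_i=\binom{n_i}{2}^{-1}\sum_{1\le j<j'\le n_i}\frac{(Y_{ij}-Y_{ij'})^2}{2},\quad i=1,\ldots,k,$$ and the between-treatment generalized $U$-statistics $$U_{ii'}=(n_in_{i'})^{-1}\sum_{j=1}^{n_i}\sum_{j'=1}^{n_{i'}}\frac{(Y_{ij}-Y_{i'j'})^2}{2},\quad 1\le i<i'\le k.$$ Set $$W_n=\sum_{i=1}^k\frac{n_i}{n}U_i,\qquad B_n=\sum_{1\le i<i'\le k}\frac{n_in_{i'}}{n(n-1)}\{2U_{ii'}-U_i-U_{i'}\}.$$ List the observations lexicographically as $Y_1,\ldots,Y_n$ (the first $n_1$ from treatment 1, the next $n_2$ from treatment 2, and so on). For $1\le r\neq s\le n$ define the weights $\eta_{nrs}=(n-n_i)/(n_i-1)$ if $Y_r$ and $Y_s$ are both observed under the $i$-th treatment, and $\eta_{nrs}=-1$ otherwise. Set $M_n=\sum_{1\le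 r<s\le n}\eta_{nrs}^2$. The symbol $\xrightarrow{D}$ denotes convergence in distribution.
   Formalization: Since the law of b_i varies with n, finiteness of its fourth moment is replaced by: E[b_i^4] is finite for each k and tends to 0 as k→∞ (true e.g. if b_i=σ_b ξ_i with ξ_i of fixed law). With mere finiteness the claim fails: b_i=±n^{1/4} with probability δ²/(2n) each, otherwise 0. *)

(* Defs.v *)
From HB Require Import structures.
From mathcomp Require Import all_boot all_order all_algebra.
From mathcomp Require Import all_classical all_reals all_analysis.
From mathcomp Require Import measurable_realfun.

Set Implicit Arguments.
Unset Strict Implicit.
Unset Printing Implicit Defensive.

Import Order.TTheory GRing.Theory Num.Theory.
Import numFieldNormedType.Exports.

Local Open Scope classical_set_scope.
Local Open Scope ring_scope.

Section probability_notions.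
Context (R : realType).

Definition same_distribution d d' (T : measurableType d) (T' : measurableType d')
    (P : probability T R) (P' : probability T' R)
    (X : {RV P >-> R}) (X' : {RV P' >-> R}) : Prop :=
  forall A : set R, measurable A -> distribution P X A = distribution P' X' A.

Definition mutually_independent d (T : measurableType d) (P : probability T R)
    (I : finType) (X : I -> {RV P >-> R}) : Prop :=
  forall (F : {set I}) (A : I -> set R), (forall i, measurable (A i)) ->
    P (\bigcap_(i in [set` F]) X i @^-1` A i) =
    (\prod_(i in F) P (X i @^-1` A i))%E.

Definition cvg_in_distribution (d : nat -> measure_display)
    (T : forall k, measurableType (d k)) (P : forall k, probability (T k) R)
    (X : forall k, {RV (P k) >-> R}) (Q : probability (measurableTypeR R) R) : Prop :=
  forall x : R, {for x, continuous (fun t : R => Q `]-oo, t]%classic)} ->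
    (fun k => @cdf _ _ _ (P k) (X k) x) @ \oo --> Q `]-oo, x]%classic.

End probability_notions.
Arguments same_distribution {R d d' T T'} P P' X X'.
Arguments mutually_independent {R d T} P {I} X.
Arguments cvg_in_distribution {R d T} P X Q.

(* A design with k treatments is given by its treatment sizes m : 'I_k -> nat,
   and a sample by its values y i j with i : 'I_k and j : 'I_(m i). *)
Section design.
Context (R : realType) (k : nat) (m : 'I_k -> nat).

Definition nobs : nat := (\sum_i m i)%N.

(* tagnat.sig1 r is the treatment of the r-th observation when the pairs (i, j)
   are listed lexicographically. *)
Definition eta (r s : 'I_nobs) : R :=
  let i := tagnat.sig1 r in
  if i == tagnat.sig1 s then (nobs%:R - (m i)%:R) / ((m i)%:R - 1) else -1.

Definition Mstat : R := \sum_(r < nobs) \sum_(s < nobs | (r < s)%N) eta r s ^+ 2.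

Section statistics.
Variable y : forall i : 'I_k, 'I_(m i) -> R.

Definition Uwithin (i : 'I_k) : R :=
  ('C(m i, 2))%:R^-1 *
  \sum_(j < m i) \sum_(j' < m i | (j < j')%N) (y j - y j') ^+ 2 / 2.

Definition Ubetween (i i' : 'I_k) : R :=
  (m i * m i')%:R^-1 *
  \sum_(j < m i) \sum_(j' < m i') (y j - y j') ^+ 2 / 2.

Definition Wstat : R := \sum_(i < k) (m i)%:R / nobs%:R * Uwithin i.

Definition Bstat : R :=
  \sum_(i < k) \sum_(i' < k | (i < i')%N)
    (m i * m i')%:R / (nobs%:R * (nobs%:R - 1)) *
    (2 * Ubetween i i' - Uwithin i - Uwithin i').

Definition Jstat : R :=
  ('C(nobs, 2))%:R * Bstat / (Wstat * Num.sqrt Mstat).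

End statistics.
End design.

Section random_effects_model.
Context (R : realType) d (T : measurableType d) (P : probability T R).
Context (k : nat) (m : 'I_k -> nat).
Variables (mu : R) (b : 'I_k -> {RV P >-> R}).
Variable e : forall i : 'I_k, 'I_(m i) -> {RV P >-> R}.

Definition Yobs (i : 'I_k) (j : 'I_(m i)) (w : T) : R := mu + b i w + e j w.

Definition effects_and_errors (x : 'I_k + {i : 'I_k & 'I_(m i)}) : {RV P >-> R} :=
  match x with
  | inl i => b i
  | inr p => e (tagged p)
  end.

Definition Jrv (w : T) : R := Jstat (fun i j => @Yobs i j w).

Let measurable_Yobs i (j : 'I_(m i)) : measurable_fun setT (Yobs j).
Proof. by apply: measurable_funD => //; apply: measurable_funD. Qed.

Let measurable_sum_cond n (Q : pred 'I_n) (f : 'I_n -> T -> R) :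
    (forall i, measurable_fun setT (f i)) ->
  measurable_fun setT (fun w => \sum_(i < n | Q i) f i w).
Proof.
move=> mf; rewrite (_ : (fun _ => _) =
    fun w => \sum_(i < n) if Q i then f i w else 0); last first.
  by apply/funext => w; rewrite big_mkcond.
by apply: measurable_sum => i; case: (Q i).
Qed.

Let measurable_Ysq i i' (j : 'I_(m i)) (j' : 'I_(m i')) :
  measurable_fun setT (fun w => (Yobs j w - Yobs j' w) ^+ 2 / 2).
Proof.
apply: measurable_funM => //; apply: measurable_funX.
by apply: measurable_funB; exact: measurable_Yobs.
Qed.

Let measurable_Uwithin i :
  measurable_fun setT (fun w => Uwithin (fun i j => @Yobs i j w) i).
Proof.
apply: measurable_funM => //; apply: measurable_sum => j.
by apply: measurable_sum_cond => j'; exact: measurable_Ysq.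
Qed.

Let measurable_Ubetween i i' :
  measurable_fun setT (fun w => Ubetween (fun i j => @Yobs i j w) i i').
Proof.
apply: measurable_funM => //; apply: measurable_sum => j.
by apply: measurable_sum => j'; exact: measurable_Ysq.
Qed.

Let measurable_invr : measurable_fun setT (fun x : R => x^-1).
Proof.
have -> : (fun x : R => x^-1) = (fun x => x * (x ^+ 2) `^ (-1)).
  apply/funext => x; rewrite powR_inv1 ?sqr_ge0//.
  by have [->|x0] := eqVneq x 0; rewrite ?invr0 ?mul0r// expr2 invfM mulVKf.
apply: measurable_funM => //.
apply: (measurableT_comp (measurable_powR _)).
exact: measurable_funX.
Qed.

Lemma measurable_Jrv : measurable_fun setT Jrv.
Proof.
apply: measurable_funM.
  apply: measurable_funM => //; apply: measurable_sum => i.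
  apply: measurable_sum_cond => i'; apply: measurable_funM => //.
  apply: measurable_funB; last exact: measurable_Uwithin.
  apply: measurable_funB; last exact: measurable_Uwithin.
  by apply: measurable_funM => //; exact: measurable_Ubetween.
apply: (measurableT_comp measurable_invr); apply: measurable_funM => //.
apply: measurable_sum => i; apply: measurable_funM => //.
Qed.

HB.instance Definition _ :=
  isMeasurableFun.Build _ _ _ _ Jrv measurable_Jrv.

End random_effects_model.

(* Main.v *)
From HB Require Import structures.
Require Import Defs.
From mathcomp Require Import all_boot all_order all_algebra.
From mathcomp Require Import all_classical all_reals all_analysis.
From mathcomp Require Import measurable_realfun ring lra.

(** The Y_r enter the numerator of J only through products of distinct
    observations, and the weights eta have zero row sums, so with
    x_ij = b_i + e_ij it equals sum_i a_i V_i - sum_(i < i') S_i S_i', where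
    a_i = (n - m_i) / (m_i - 1), V_i is the sum of the products of pairs
    within treatment i and S_i = sum_j x_ij. Since M has order n^3 and the
    second sum has order n, only the independent terms a_i V_i matter. Expanding
    V_i = C(m_i, 2) b_i^2 + (m_i - 1) b_i E_i + G_i with E_i = sum_j e_ij and
    G_i = sum_(j < j') e_ij e_ij', the first part tends to the shift of the mean
    (its fluctuations are killed by the vanishing fourth moments of b), the second
    one to 0, and sum_i a_i G_i is asymptotically normal.

    The central limit theorem is proved by Stein's method. For a Lipschitz test
    function h with compact support and Gaussian mean 0 the solution f of
    f' - (x - c) f = h again has compact support, so its bounds come for free from
    compactness; tightness then brings in general test functions. The fourth
    moment of G_i is finite because G_i is a sum of products of two independent
    factors, so the Lyapunov condition holds. *)

Import Order.TTheory GRing.Theory Num.Theory.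
Import numFieldNormedType.Exports.

Local Open Scope classical_set_scope.
Local Open Scope ring_scope.

(** * Expectations and independence *)

(** Scale governs the error terms. After division by [v * sqrt M] each a_i is at most of order
    n^(-1/2), and there are at most n treatments, so the second moment of a sum of centered
    independent block terms stays bounded but gains no decay from averaging. Each remainder must
    therefore bring its own small factor: the b_i^2 part the fourth moment of b, the cross part the
    variance tau of the effects. The products of totals of different treatments have an absolute
    mean of order n, against n^(3/2) for sqrt M. All these rates rest on the lower bound n^3 / (8 N)
    for M, which also makes lambda positive.

    The limit mean comes from a_i C(m_i, 2) = (n - m_i) m_i / 2: the sum over i is n^2 / 2 up to
    order n, and multiplied by tau it is delta^2 n^(3/2) / 2, against v sqrt(lambda) n^(3/2) in the
    denominator.

    Centering the test function is what confines the Stein solution to a compact set: the primitive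
    of h times the density then vanishes on both sides of the support of h. An indicator is not such
    a function, so it is replaced by a trapezoid minus a multiple of a wide bump. *)

Lemma measurable_ge_cst {R : realType} {d} {T : measurableType d} (f : T -> R) a :
  measurable_fun setT f -> measurable [set w | a <= f w].
Proof.
move=> mf; have := mf measurableT _ (measurable_itv `[a, +oo[); rewrite setTI.
by congr measurable; apply/seteqP; split => w /=; rewrite in_itv/= andbT.
Qed.

Lemma measurable_le_cst {R : realType} {d} {T : measurableType d} (f : T -> R) a :
  measurable_fun setT f -> measurable [set w | f w <= a].
Proof.
move=> mf; have := mf measurableT _ (measurable_itv `]-oo, a]); rewrite setTI.
by congr measurable; apply/seteqP; split => w /=; rewrite in_itv/=.
Qed.

Section real_expectation.
Context {R : realType} {d} {T : measurableType d} (P : probability T R).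
Implicit Types f g : T -> R.

(** Expectations and probabilities are kept in [R] rather than in the extended reals, so that [lra],
    [nra] and [ring] apply; the price is an integrability side condition in the linearity rules. *)
Definition integrableR f := P.-integrable setT (EFin \o f).
Definition Exp f : R := \int[P]_w f w.
Definition Pr (A : set T) : R := fine (P A).

Lemma integrableR_measurable {f} : integrableR f -> measurable_fun setT f.
Proof. by move=> /measurable_int/measurable_EFinP. Qed.

Lemma integrableR_cst c : integrableR (fun=> c).
Proof. exact: finite_measure_integrable_cst. Qed.

Lemma integrableRD {f g} : integrableR f -> integrableR g ->
  integrableR (fun w => f w + g w).
Proof. by move=> fi gi; exact: (integrableD measurableT fi gi). Qed.

Lemma integrableRB {f g} : integrableR f -> integrableR g ->
  integrableR (fun w => f w - g w).
Proof. by move=> fi gi; exact: (integrableB measurableT fi gi). Qed.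

Lemma integrableRZ c {f} : integrableR f -> integrableR (fun w => c * f w).
Proof. by move=> fi; exact: (integrableZl measurableT c fi). Qed.

Lemma integrableR_norm {f} : integrableR f -> integrableR (fun w => `|f w|).
Proof. by move=> fi; exact: integrable_norm. Qed.

Lemma integrableR_le {f} g : measurable_fun setT f ->
  (forall w, `|f w| <= g w) -> integrableR g -> integrableR f.
Proof.
move=> mf fg; apply: le_integrable => //; first exact/measurable_EFinP.
by move=> w _ /=; rewrite lee_fin (le_trans (fg w))// ler_norm.
Qed.

Lemma integrableR_bounded {f} c : measurable_fun setT f ->
  (forall w, `|f w| <= c) -> integrableR f.
Proof. by move=> mf fc; apply: (integrableR_le (fun=> c)) => //; exact: integrableR_cst. Qed.

Lemma integrableR_sum (I : Type) (s : seq I) (Q : pred I) (f : I -> T -> R) :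
  (forall i, Q i -> integrableR (f i)) ->
  integrableR (fun w => \sum_(i <- s | Q i) f i w).
Proof.
move=> fi; elim: s => [|i s IH].
  have -> : (fun w => \sum_(i <- [::] | Q i) f i w) = fun=> 0.
    by apply/funext => w; rewrite big_nil.
  exact: integrableR_cst.
have -> : (fun w => \sum_(j <- i :: s | Q j) f j w) = fun w =>
    if Q i then f i w + \sum_(j <- s | Q j) f j w else \sum_(j <- s | Q j) f j w.
  by apply/funext => w; rewrite big_cons.
by case Qi : (Q i) => //; apply: integrableRD => //; exact: fi.
Qed.

Lemma Exp_cst c : Exp (fun=> c) = c.
Proof. by rewrite /Exp Rintegral_cst// [X in fine X]probability_setT/= mulr1. Qed.

Lemma ExpD f g : integrableR f -> integrableR g ->
  Exp (fun w => f w + g w) = Exp f + Exp g.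
Proof. exact: RintegralD. Qed.

Lemma ExpB f g : integrableR f -> integrableR g ->
  Exp (fun w => f w - g w) = Exp f - Exp g.
Proof. exact: RintegralB. Qed.

Lemma ExpZ c f : integrableR f -> Exp (fun w => c * f w) = c * Exp f.
Proof. exact: RintegralZl. Qed.

Lemma Exp_ge0 f : (forall w, 0 <= f w) -> 0 <= Exp f.
Proof. by move=> f0; apply: Rintegral_ge0. Qed.

Lemma le_Exp f g : integrableR f -> integrableR g ->
  (forall w, f w <= g w) -> Exp f <= Exp g.
Proof. by move=> fi gi fg; exact: le_Rintegral. Qed.

Lemma normr_Exp f : integrableR f -> `|Exp f| <= Exp (fun w => `|f w|).
Proof. exact: le_normr_Rintegral. Qed.

Lemma Exp_sum (I : Type) (s : seq I) (Q : pred I) (f : I -> T -> R) :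
  (forall i, Q i -> integrableR (f i)) ->
  Exp (fun w => \sum_(i <- s | Q i) f i w) = \sum_(i <- s | Q i) Exp (f i).
Proof.
move=> fi; elim: s => [|i s IH].
  have -> : (fun w => \sum_(i <- [::] | Q i) f i w) = fun=> 0.
    by apply/funext => w; rewrite big_nil.
  by rewrite Exp_cst big_nil.
have -> : (fun w => \sum_(j <- i :: s | Q j) f j w) = fun w =>
    if Q i then f i w + \sum_(j <- s | Q j) f j w else \sum_(j <- s | Q j) f j w.
  by apply/funext => w; rewrite big_cons.
rewrite big_cons; case Qi : (Q i) => //; rewrite ExpD ?IH//; first exact: fi.
exact: integrableR_sum.
Qed.

Lemma Exp_expectation f : integrableR f -> ('E_P[f] = (Exp f)%:E)%E.
Proof.
by move=> fi; rewrite unlock /Exp /Rintegral fineK//; exact: integrable_fin_num.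
Qed.

Lemma integrableR_expectation f : measurable_fun setT f ->
  (forall w, 0 <= f w) -> ('E_P[f] < +oo)%E -> integrableR f.
Proof.
rewrite unlock => mf f0 foo; apply/integrableP; split.
  exact/measurable_EFinP.
by under eq_integral do rewrite /= ger0_norm//.
Qed.

Lemma PrE A : measurable A -> P A = (Pr A)%:E.
Proof.
by move=> mA; rewrite /Pr fineK// ge0_fin_numE// (le_lt_trans (probability_le1 _ mA))// ltry.
Qed.

Lemma Pr_ge0 A : 0 <= Pr A. Proof. exact: fine_ge0. Qed.

Lemma Pr_Exp A : measurable A -> Pr A = Exp \1_A.
Proof. by move=> mA; rewrite /Pr /Exp /Rintegral integral_indic// setIT. Qed.

Lemma integrableR_indic A : measurable A -> integrableR \1_A.
Proof. by move=> mA; exact: integrable_indic. Qed.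

Lemma le_Pr A B : measurable A -> measurable B -> A `<=` B -> Pr A <= Pr B.
Proof.
by move=> mA mB AB; rewrite -lee_fin -!PrE// le_measure// inE.
Qed.

Lemma Pr_le1 A : measurable A -> Pr A <= 1.
Proof. by move=> mA; rewrite -lee_fin -PrE// probability_le1. Qed.

Lemma Pr_setU A B : measurable A -> measurable B -> Pr (A `|` B) <= Pr A + Pr B.
Proof.
move=> mA mB; rewrite -lee_fin EFinD -!PrE//; last exact: measurableU.
exact: measureU2.
Qed.

Lemma Pr_markov f a : 0 < a -> integrableR f -> (forall w, 0 <= f w) ->
  Pr [set w | a <= f w] <= Exp f / a.
Proof.
move=> a0 fi f0; rewrite ler_pdivlMr// mulrC.
have mA : measurable [set w | a <= f w].
  exact/measurable_ge_cst/integrableR_measurable.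
rewrite Pr_Exp// -ExpZ; last exact: integrableR_indic.
apply: le_Exp => //; first exact/integrableRZ/integrableR_indic.
move=> w; rewrite indicE; have [/set_mem|_] := boolP (w \in _).
  by move=> /= ; rewrite mulr1.
by rewrite mulr0.
Qed.

End real_expectation.

(** * Product expectations and independence of disjoint groups of coordinates *)

Section independence.
Context {R : realType} {d} {T : measurableType d} (P : probability T R).

Definition independent2 (f g : T -> R) : Prop :=
  forall A B : set R, measurable A -> measurable B ->
    P (f @^-1` A `&` g @^-1` B) = (P (f @^-1` A) * P (g @^-1` B))%E.

Section expectation_product.
Variables f g : T -> R.
Hypotheses (mf : measurable_fun setT f) (mg : measurable_fun setT g).
Hypothesis fg : independent2 f g.

Let F : {mfun T >-> R} := mfun_Sub (mem_set mf).
Let G : {mfun T >-> R} := mfun_Sub (mem_set mg).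
Let mH : measurable_fun setT (fun w => (f w, g w)) := measurable_fun_pair mf mg.
Let H : {mfun T >-> (R * R)%type} := mfun_Sub (mem_set mH).
Let mulE (z : R * R) : \bar R := (z.1 * z.2)%:E.

Let measurable_mulE : measurable_fun setT mulE.
Proof. by apply/measurable_EFinP; exact: measurable_funM. Qed.

(** Independence gives equality of the two measures on rectangles, and uniqueness of the product
    measure extends it. *)
Let joint_law (h : R * R -> \bar R) :
  (\int[distribution P F \x distribution P G]_z h z =
   \int[distribution P H]_z h z)%E.
Proof.
apply: eq_measure_integral => A mA _.
by apply: product_measure_unique => // B C mB mC; exact: fg.
Qed.

Hypotheses (fi : integrableR P f) (gi : integrableR P g).

Let abs_fin (h : T -> R) (mh : measurable_fun setT h) : integrableR P h ->
  (\int[distribution P (mfun_Sub (mem_set mh))]_x (`|x|)%:E =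
    (Exp P (fun w => `|h w|))%:E)%E.
Proof.
move=> hi; rewrite ge0_integral_distribution//; last exact/measurable_EFinP.
by rewrite /Exp /Rintegral fineK//; apply: integrable_fin_num => //; exact: integrable_norm.
Qed.

(** By Tonelli the iterated integral of [|x * y|] is the product of the two absolute first moments;
    no second moments enter. *)
Let integrable_mulE : (distribution P F \x distribution P G)%E.-integrable setT mulE.
Proof.
apply/(integrable12ltyP _ _ measurable_mulE).
under eq_integral => x _.
  under eq_integral do rewrite /mulE/= normrM EFinM.
  rewrite ge0_integralZl//; last exact/measurable_EFinP.
  rewrite abs_fin//; over.
rewrite ge0_integralZr//; [|exact/measurable_EFinP|].
  by rewrite abs_fin// -EFinM ltry.
by rewrite lee_fin; exact: Exp_ge0.
Qed.

Lemma independent2_integrableM : integrableR P (fun w => f w * g w).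
Proof.
apply/integrableP; split; first exact/measurable_EFinP/measurable_funM.
have /integrableP[_] := integrable_mulE.
rewrite joint_law ge0_integral_distribution//.
exact: measurableT_comp.
Qed.

Lemma independent2_ExpM : Exp P (fun w => f w * g w) = Exp P f * Exp P g.
Proof.
have fE : (\int[distribution P F]_x x%:E = (Exp P f)%:E)%E.
  by rewrite integral_distribution//; exact/esym/fineK/integrable_fin_num.
have gE : (\int[distribution P G]_x x%:E = (Exp P g)%:E)%E.
  by rewrite integral_distribution//; exact/esym/fineK/integrable_fin_num.
have Fi : (distribution P F).-integrable setT (EFin : R -> \bar R).
  by apply: integrable_pushforward => //; exact/measurable_EFinP.
have Gi : (distribution P G).-integrable setT (EFin : R -> \bar R).
  by apply: integrable_pushforward => //; exact/measurable_EFinP.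
have := integral12_prod_meas1 integrable_mulE.
rewrite joint_law integral_distribution//; last exact: independent2_integrableM.
rewrite /fubini_F /mulE/= => E; rewrite /Exp /Rintegral.
rewrite -[X in fine X]E.
have Ein x : (\int[distribution P G]_y (x * y)%:E = x%:E * (Exp P g)%:E)%E.
  by under eq_integral do rewrite EFinM; rewrite integralZl// gE.
rewrite (eq_integral (fun x : R => x%:E * (Exp P g)%:E)%E); last by move=> x _; exact: Ein.
by rewrite integralZr// fE -EFinM.
Qed.

End expectation_product.

Section generated.
Context {I : finType} (X : I -> {RV P >-> R}).
Hypothesis indepX : mutually_independent P X.

(* A pi-system: Dynkin's theorem extends independence from it to the
   sigma-algebra generated by the coordinates in [F]. *)
Definition cylinders (F : {set I}) : set (set T) :=
  [set C | exists A : I -> set R, (forall i, measurable (A i)) /\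
     C = \bigcap_(i in [set` F]) X i @^-1` A i].

(** Stated as measurability on the same carrier with a smaller sigma-algebra, so that the closure
    rules for measurable functions become closure rules for dependence on the coordinates in [F]. *)
Definition determined_by (F : {set I}) (f : T -> R) : Prop :=
  @measurable_fun _ _ (g_sigma_algebraType (cylinders F)) _ setT f.

Let cylinders_measurable F : cylinders F `<=` measurable.
Proof.
move=> _ [A [mA ->]]; apply: fin_bigcap_measurable => // i _.
by rewrite -[X in measurable X]setTI; exact: measurable_funP.
Qed.

Let cylindersI F : setI_closed (cylinders F).
Proof.
move=> _ _ [A [mA ->]] [B [mB ->]]; exists (fun i => A i `&` B i); split.
  by move=> i; exact: measurableI.
by rewrite -bigcapI; apply: eq_bigcapr => i _; rewrite preimage_setI.
Qed.

Let cylindersT F : cylinders F setT.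
Proof.
exists (fun=> setT); split => //; apply/esym; rewrite -subTset => w _ i _ //.
Qed.

Let cylinders_indep (F F' : {set I}) A B : [disjoint F & F']%B ->
  cylinders F A -> cylinders F' B -> P (A `&` B) = (P A * P B)%E.
Proof.
move=> FF' [a [ma ->]] [b [mb ->]].
(* Since [F] and [F'] are disjoint, one family [c] serves both: the two intersections merge into a
   single one over the union, to which mutual independence applies. *)
pose c i := if i \in F then a i else b i.
have mc i : measurable (c i) by rewrite /c; case: ifP.
have ca i : i \in F -> c i = a i by rewrite /c => ->.
have cb i : i \in F' -> c i = b i.
  by rewrite /c; case: ifP => // iF; rewrite (disjointFr FF' iF).
have -> : \bigcap_(i in [set` F]) X i @^-1` a i = \bigcap_(i in [set` F]) X i @^-1` c i.
  by apply: eq_bigcapr => i /= iF; rewrite ca.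
have -> : \bigcap_(i in [set` F']) X i @^-1` b i = \bigcap_(i in [set` F']) X i @^-1` c i.
  by apply: eq_bigcapr => i /= iF; rewrite cb.
rewrite -bigcap_setU.
have -> : [set` F] `|` [set` F'] = [set` (F :|: F')%SET].
  by apply/seteqP; split => i /=; rewrite finset.inE => /orP.
rewrite !indepX//=.
rewrite (big_setID F)/=; congr (_ * _)%E; apply: eq_bigl => i; rewrite !finset.inE.
  by case: (i \in F); rewrite ?andbF.
by case iF : (i \in F); rewrite //= (disjointFr FF' iF).
Qed.

(** For fixed [B], P(A & B) and P(B) P(A) are finite measures in A that agree on a pi-system
    containing the whole space, hence on the sigma-algebra that it generates. *)
Let extend (G : set (set T)) (B : set T) : G `<=` measurable -> setI_closed G -> G setT ->
  measurable B -> (forall A, G A -> P (A `&` B) = P A * P B)%E ->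
  forall A, <<s G >> A -> P (A `&` B) = (P A * P B)%E.
Proof.
move=> Gm GI GT mB GB A GA.
pose q : {nonneg R} := NngNum (Pr_ge0 P B).
have : mrestr P mB A = mscale q P A.
  apply: (@g_sigma_algebra_measure_unique _ _ _ G Gm (fun=> setT) (fun=> GT)) GA => //.
  - by apply: bigcup_const; exists 0%N.
  - move=> C GC; change (P (C `&` B) = ((Pr P B)%:E * P C)%E).
    by rewrite GB// -PrE// muleC.
  - by move=> _; change (P (setT `&` B) < +oo)%E; rewrite setTI PrE// ltry.
change (P (A `&` B) = ((Pr P B)%:E * P A)%E -> P (A `&` B) = (P A * P B)%E).
by move=> ->; rewrite -PrE// muleC.
Qed.

Let sigma_cylinders_measurable F : <<s cylinders F >> `<=` measurable.
Proof.
by apply: smallest_sub; [exact: sigma_algebra_measurable|exact: cylinders_measurable].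
Qed.

Lemma determined_by_coord (F : {set I}) i : i \in F -> determined_by F (X i).
Proof.
move=> iF _ A mA; rewrite setTI; apply: sub_sigma_algebra.
exists (fun j => if j == i then A else setT); split; first by move=> j; case: ifP.
apply/seteqP; split => [w /= Aw j _|w /= /(_ i)]; last by rewrite eqxx; exact.
by case: ifP => // /eqP ->.
Qed.

Lemma determined_by_sub (F F' : {set I}) f : F \subset F' ->
  determined_by F f -> determined_by F' f.
Proof.
move=> /fintype.subsetP FF' mf _ A mA; have := mf measurableT A mA.
apply: smallest_sub; first exact: smallest_sigma_algebra.
move=> _ [a [ma ->]]; apply: sub_sigma_algebra.
(* A cylinder over [F] becomes one over [F'] by leaving the additional coordinates unconstrained. *)
exists (fun i => if i \in F then a i else setT); split; first by move=> i; case: ifP.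
apply/seteqP; split => [w aw i /= iF'|w aw i /= iF].
  by case: ifP => // iF; exact: aw.
by have := aw i (FF' _ iF); rewrite iF.
Qed.

(** Two uses of [extend]: one passes from cylinders over [F] to the event of [f], with the event of
    [g] fixed; the other, with a cylinder over [F] fixed, passes from cylinders over [F'] to the
    event of [g]. *)
Lemma determined_by_independent (F F' : {set I}) f g : [disjoint F & F']%B ->
  determined_by F f -> determined_by F' g -> independent2 f g.
Proof.
move=> FF' mf mg A B mA mB.
have fA : <<s cylinders F >> (f @^-1` A) by have := mf measurableT A mA; rewrite setTI.
have gB : <<s cylinders F' >> (g @^-1` B) by have := mg measurableT B mB; rewrite setTI.
apply: extend fA => //.
- exact: sigma_cylinders_measurable gB.
- move=> C FC; rewrite setIC muleC.
  apply: extend gB => //; first exact: cylinders_measurable FC.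
  by move=> D F'D; rewrite setIC muleC; exact: cylinders_indep FC F'D.
Qed.

End generated.
End independence.

(** * Stein's method *)

Definition lipschitzR {R : realType} (L : R) (h : R -> R) : Prop :=
  forall x y, `|h x - h y| <= L * `|x - y|.

Definition vanishes_outside {R : realType} (K : R) (h : R -> R) : Prop :=
  forall x, K <= `|x| -> h x = 0.

Lemma lipschitzR_continuous {R : realType} (L : R) h : lipschitzR L h -> continuous h.
Proof.
move=> hL x; apply/cvgrPdist_le => eps e0.
(* [L] has no sign assumption; [|L| + 1] is a constant that can be divided by. *)
have L1 : 0 < `|L| + 1 by rewrite ltr_wpDl.
near=> y; apply: (le_trans (hL x y)).
have : `|x - y| <= eps / (`|L| + 1).
  by near: y; apply: cvgr_dist_le; [exact: cvg_id|exact: divr_gt0].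
rewrite ler_pdivlMr// => H; apply: le_trans H; rewrite mulrC ler_wpM2l//.
by rewrite (le_trans (ler_norm _))// lerDl.
Unshelve. all: by end_near. Qed.

Lemma continuous_vanishes_bounded {R : realType} (K : R) (h : R -> R) :
  0 <= K -> continuous h -> vanishes_outside K h ->
  exists2 B, 0 <= B & forall x, `|h x| <= B.
Proof.
move=> K0 ch hK.
have cn : {within `[-K, K], continuous (fun x => `|h x|)}.
  apply: continuous_subspaceT => x; apply: continuous_comp; first exact: ch.
  exact: norm_continuous.
have KK : -K <= K by lra.
have [m mK mM] := EVT_max KK cn.
exists `|h m| => // x.
have [xK|Kx] := leP `|x| K; first by apply: mM; rewrite in_itv/= -ler_norml.
by rewrite hK ?normr0// ltW.
Qed.

Section stein_equation.
Context {R : realType} (c : R).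
Local Notation mu := (@lebesgue_measure R).
Local Notation phi := (normal_pdf c 1).

Definition normal_mean (h : R -> R) : R := \int[mu]_x (h x * phi x).

Section solution.
Variables (K L : R) (h : R -> R).
Hypotheses (K0 : 0 <= K) (hL : lipschitzR L h) (hK : vanishes_outside K h).
Hypothesis h0 : normal_mean h = 0.

Let hc : continuous h := lipschitzR_continuous _ _ hL.
Let hphi x := h x * phi x.
(** [psi] is the reciprocal of [phi], so [f] is the primitive of [h * phi] divided by the density,
    that is, the solution of the Stein equation by an integrating factor. *)
Let F x := \int[mu]_(t in `]-oo, x]) hphi t.
Let psi x : R := (normal_peak 1)^-1 * expR ((x - c) ^+ 2 / 2).
Let f x := F x * psi x.

Let hphi_continuous : continuous hphi.
Proof.
move=> x; apply: continuousM; first exact: hc.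
by apply: continuous_normal_pdf; rewrite oner_eq0.
Qed.

Let hphi_integrable : mu.-integrable setT (EFin \o hphi).
Proof.
have [B B0 hB] := continuous_vanishes_bounded K h K0 hc hK.
apply: (@integrableMr _ _ _ mu setT measurableT h (EFin \o phi)).
- exact: continuous_measurable_fun.
- by exists B; split; [exact: num_real|move=> x Bx y _ /=; exact: le_trans (hB y) (ltW Bx)].
- exact: integrable_normal_pdf.
Qed.

Let F_derive (x : R) : is_derive x 1 F (hphi x).
Proof.
have [] := @continuous_FTC1 R hphi -oo%O x (x + 1) _ _ _ (@hphi_continuous x).
- by rewrite ltrDl.
- exact: integrableS hphi_integrable.
- by rewrite ltNyr.
- by move=> dF dFE; split => //; rewrite -derive1E.
Qed.

(** To the left of the support the integrand is zero; to the right the integral is already the whole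
    normal mean of [h]. This is where the centering [h0] enters. *)
Let F_out x : K <= `|x| -> F x = 0.
Proof.
have [x0|x0] := leP 0 x.
  rewrite ger0_norm// => Kx; rewrite /F Rintegral_mkcond.
  have -> : hphi \_ `]-oo, x] = hphi; last exact: h0.
  apply/funext => y; rewrite patchE; case: ifPn => // /negP yx.
  rewrite /hphi hK ?mul0r//; apply: contra_notT yx; rewrite -ltNge => yK.
  rewrite inE/= in_itv/= (le_trans (ler_norm _))// (le_trans (ltW yK))//.
rewrite ltr0_norm// => Kx; rewrite /F Rintegral_mkcond.
have -> : hphi \_ `]-oo, x] = fun=> 0.
  apply/funext => y; rewrite patchE; case: ifPn => //.
  rewrite inE/= in_itv/= => yx; rewrite /hphi hK ?mul0r//.
  by rewrite ler0_norm; lra.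
by rewrite Rintegral_cst// mul0r.
Qed.

Let psi_derive (x : R) : is_derive x 1 psi ((x - c) * psi x).
Proof.
rewrite /psi; apply: is_derive_eq.
by rewrite /GRing.scale/= !mulr0 add0r; set p := (normal_peak 1)^-1; field.
Qed.

Let phi_psi x : phi x * psi x = 1.
Proof.
rewrite normal_pdfE ?oner_eq0// /psi /normal_fun.
rewrite mulrACA mulfV ?gt_eqF ?normal_peak_gt0 ?oner_eq0// mul1r -expRD.
rewrite -[RHS]expR0; congr expR; lra.
Qed.

Let f' x := (x - c) * f x + h x.

Let f_derive (x : R) : is_derive x 1 f (f' x).
Proof.
suff -> : f' x = F x *: ((x - c) * psi x) + psi x *: hphi x by exact: is_deriveM.
rewrite /f' /f /GRing.scale/= /hphi.
transitivity ((x - c) * (F x * psi x) + h x * (phi x * psi x)); last by ring.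
by rewrite phi_psi mulr1.
Qed.

Let f_continuous : continuous f.
Proof.
by move=> x; apply/differentiable_continuous/derivable1_diffP; exact: (@ex_derive _ _ _ _ _ _ _ (f_derive x)).
Qed.

Let f_out : vanishes_outside K f.
Proof. by move=> x Kx; rewrite /f F_out ?mul0r. Qed.

(** On the support [|x - c|] is at most [K + |c|], so the equation itself bounds the derivative, and
    a Lipschitz bound for the derivative reduces to one for [(x - c) * f x]. The three constants are
    merged into one [B]. *)
Lemma stein_solution : exists g g' : R -> R, exists B, [/\ continuous g,
  (forall x : R, is_derive x 1 g (g' x)),
  (forall x, g' x - (x - c) * g x = h x),
  0 <= B & [/\ (forall x, `|g x| <= B), (forall x, `|g' x| <= B) & lipschitzR B g']].
Proof.
have [B1 B10 fB] := continuous_vanishes_bounded K f K0 f_continuous f_out.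
have [B2 B20 hB] := continuous_vanishes_bounded K h K0 hc hK.
pose B3 := (K + `|c|) * B1 + B2.
have B30 : 0 <= B3 by rewrite addr_ge0// mulr_ge0// addr_ge0.
have f'B x : `|f' x| <= B3.
  have [xK|Kx] := leP `|x| K; last by rewrite /f' f_out ?hK ?mulr0 ?addr0 ?normr0// ltW.
  rewrite (le_trans (ler_normD _ _))// lerD// normrM ler_pM//.
  by rewrite (le_trans (ler_normB _ _))// lerD2r.
have flip x y : `|f x - f y| <= B3 * `|x - y|.
  wlog xy : x y / x < y.
    move=> W; have [xy|yx|->] := ltgtP x y; first exact: W.
      by rewrite distrC (distrC x); exact: W.
    by rewrite !subrr normr0 mulr0.
  have [z _ E] := MVT xy (fun z _ => f_derive z) (continuous_subspaceT f_continuous).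
  by rewrite distrC E normrM (distrC x) ler_wpM2r.
have L0 : 0 <= L.
  by have := hL 0 1; rewrite sub0r normrN1 mulr1; apply: le_trans.
have mlip x y : `|(x - c) * f x - (y - c) * f y| <= ((K + `|c|) * B3 + B1) * `|x - y|.
  (* The difference is split so that [u - c], the factor bounded by [|u| <= K], multiplies the
     increment of [f]. If neither point lies in the support, both terms are zero. *)
  have main u v : `|u| <= K ->
      `|(u - c) * f u - (v - c) * f v| <= ((K + `|c|) * B3 + B1) * `|u - v|.
    move=> uK.
    have -> : (u - c) * f u - (v - c) * f v = (u - c) * (f u - f v) + f v * (u - v) by ring.
    rewrite (le_trans (ler_normD _ _))// (normrM (u - c)) (normrM (f v)) [leRHS]mulrDl.
    rewrite lerD ?ler_wpM2r// -mulrA ler_pM//.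
    by rewrite (le_trans (ler_normB _ _))// lerD2r.
  have [xK|Kx] := leP `|x| K; first exact: main.
  have [yK|Ky] := leP `|y| K; first by rewrite distrC (distrC x); exact: main.
  rewrite (f_out _ (ltW Kx)) (f_out _ (ltW Ky)) !mulr0 subrr normr0.
    by rewrite mulr_ge0// addr_ge0// mulr_ge0// addr_ge0.
pose B4 := (K + `|c|) * B3 + B1 + L.
have B40 : 0 <= B4 by rewrite !addr_ge0// mulr_ge0// addr_ge0.
exists f, f', (B1 + B3 + B4); split => //.
- by move=> x; rewrite /f'; ring.
- by rewrite addr_ge0// addr_ge0.
- split.
  + by move=> x; rewrite (le_trans (fB x))//; lra.
  + by move=> x; rewrite (le_trans (f'B x))//; lra.
  + move=> x y; apply: (@le_trans _ _ (B4 * `|x - y|)); last first.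
      by rewrite ler_wpM2r//; lra.
    rewrite /f'.
    have -> : (x - c) * f x + h x - ((y - c) * f y + h y) =
      ((x - c) * f x - (y - c) * f y) + (h x - h y) by ring.
    by rewrite (le_trans (ler_normD _ _))// [leRHS]mulrDl lerD.
Qed.

End solution.
End stein_equation.

(** * Leave-one-out bound for sums of independent variables *)

Section stein_bound.
Context {R : realType} {d} {T : measurableType d} (P : probability T R).

Lemma independent2_comp (u v : R -> R) (f g : T -> R) :
  measurable_fun setT u -> measurable_fun setT v -> independent2 P f g ->
  independent2 P (u \o f) (v \o g).
Proof.
move=> mu mv fg A B mA mB; apply: (fg (u @^-1` A) (v @^-1` B)).
- by rewrite -[X in measurable X]setTI; exact: mu.
- by rewrite -[X in measurable X]setTI; exact: mv.
Qed.

Context {I : finType} (c B : R) (xi : I -> T -> R) (h g g' : R -> R).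
Hypotheses (mxi : forall i, measurable_fun setT (xi i))
  (xi1 : forall i, integrableR P (xi i))
  (xi2 : forall i, integrableR P (fun w => xi i w ^+ 2))
  (xi3 : forall i, integrableR P (fun w => `|xi i w| ^+ 3))
  (xi0 : forall i, Exp P (xi i) = 0)
  (xi_indep : forall i, independent2 P (xi i) (fun w => \sum_(l | l != i) xi l w)).
Hypotheses (gc : continuous g) (dg : forall x : R, is_derive x 1 g (g' x))
  (gg' : forall x, g' x - (x - c) * g x = h x) (B0 : 0 <= B)
  (gB : forall x, `|g x| <= B) (g'B : forall x, `|g' x| <= B) (g'L : lipschitzR B g').

Let Z w := c + \sum_i xi i w.
Let Y i w := c + \sum_(l | l != i) xi l w.

Let ZE i w : Z w = Y i w + xi i w.
Proof. by rewrite /Z /Y (bigD1 i)//=; ring. Qed.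

Let mY i : measurable_fun setT (Y i).
Proof.
apply: measurable_funD => //.
have -> : (fun w => \sum_(l | l != i) xi l w) = fun w => \sum_l if l != i then xi l w else 0.
  by apply/funext => w; rewrite big_mkcond.
by apply: measurable_sum => l; case: (l != i).
Qed.

Let mZ : measurable_fun setT Z.
Proof. by apply: measurable_funD => //; exact: measurable_sum. Qed.

Let mg : measurable_fun setT g. Proof. exact: continuous_measurable_fun. Qed.

Let mg' : measurable_fun setT g'.
Proof. by apply: continuous_measurable_fun; exact: (lipschitzR_continuous B). Qed.

Let ibound (f : R -> R) (X : T -> R) : measurable_fun setT f -> measurable_fun setT X ->
  (forall x, `|f x| <= B) -> integrableR P (fun w => f (X w)).
Proof.
move=> mf mX fB; apply: (integrableR_bounded P B) => //.
exact: measurableT_comp.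
Qed.

Let imul (f : R -> R) (X : T -> R) (V : T -> R) :
  measurable_fun setT f -> measurable_fun setT X -> integrableR P V ->
  (forall x, `|f x| <= B) -> integrableR P (fun w => V w * f (X w)).
Proof.
move=> mf mX iV fB; apply: (integrableR_le P (fun w => B * `|V w|)).
- apply: measurable_funM; first exact: integrableR_measurable iV.
  exact: measurableT_comp.
- by move=> w; rewrite normrM mulrC ler_wpM2r.
- exact/integrableRZ/integrableR_norm.
Qed.

(** One mean value theorem with a Lipschitz derivative; the factor 1/2 of the Taylor remainder is
    given up. *)
Let taylor x t : `|g (x + t) - g x - t * g' x| <= B * t ^+ 2.
Proof.
have main u v : u < v -> exists2 z, u <= z <= v & g v - g u = g' z * (v - u).
  move=> uv; have [z zuv E] := MVT uv (fun z _ => dg z) (continuous_subspaceT gc).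
  by exists z => //; move: zuv; rewrite in_itv/= => /andP[/ltW -> /ltW ->].
have [z zt E] : exists2 z, `|z - x| <= `|t| & g (x + t) - g x = g' z * t.
  have [t0|t0|->] := ltgtP t 0.
  - have [z /andP[z1 z2] E] := main (x + t) x (ltac:(lra)).
    exists z; last by rewrite -opprB E; ring.
    rewrite (ltr0_norm t0) ler0_norm; lra.
  - have [z /andP[z1 z2] E] := main x (x + t) (ltac:(lra)).
    exists z; last by rewrite E; ring.
    rewrite (gtr0_norm t0) ger0_norm; lra.
  - by exists x; rewrite ?subrr ?normr0// addr0 mulr0 subrr.
have -> : g (x + t) - g x - t * g' x = (g' z - g' x) * t by rewrite E; ring.
rewrite normrM -normr_id -[t ^+ 2]ger0_norm ?sqr_ge0// normrX expr2 mulrA normr_id.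
rewrite ler_wpM2r// (le_trans (g'L z x))// ler_wpM2l//.
Qed.

(** [g (Z w)] is expanded around [Y i w], the sum without [xi i]. By independence the zeroth-order
    term has mean zero and the first-order term factors; the Taylor remainder costs the third
    moment, and replacing [Y i] by [Z] in [g'] costs [B] times the absolute moment. *)
Let step i : `|Exp P (fun w => xi i w * g (Z w)) -
    Exp P (fun w => xi i w ^+ 2) * Exp P (fun w => g' (Z w))| <=
  B * (Exp P (fun w => `|xi i w| ^+ 3) +
       Exp P (fun w => xi i w ^+ 2) * Exp P (fun w => `|xi i w|)).
Proof.
pose D w := xi i w * (g (Z w) - g (Y i w) - xi i w * g' (Y i w)).
have i1 : integrableR P (fun w => xi i w * g (Z w)) by exact: imul.
have i2 : integrableR P (fun w => xi i w * g (Y i w)) by exact: imul.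
have i3 : integrableR P (fun w => xi i w ^+ 2 * g' (Y i w)) by exact: imul.
have DE : D = fun w => (xi i w * g (Z w) - xi i w * g (Y i w)) - xi i w ^+ 2 * g' (Y i w).
  by apply/funext => w; rewrite /D; ring.
have iD : integrableR P D by rewrite DE; do 2 apply: integrableRB => //.
have ED : Exp P D = Exp P (fun w => xi i w * g (Z w)) -
    Exp P (fun w => xi i w ^+ 2) * Exp P (fun w => g' (Y i w)).
  rewrite DE ExpB//; last exact: integrableRB.
  rewrite ExpB//.
  rewrite (independent2_ExpM P (xi i) (fun w => g (Y i w))) ?xi0 ?mul0r ?subr0//.
  - rewrite (independent2_ExpM P (fun w => xi i w ^+ 2) (fun w => g' (Y i w)))//.
    + exact: measurable_funX.
    + exact: measurableT_comp.
    + apply: (independent2_comp (fun x => x ^+ 2) (fun x => g' (c + x))) => //.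
        by apply: measurableT_comp mg' _; exact: measurable_funD.
    + exact: ibound.
  - exact: measurableT_comp.
  - apply: (independent2_comp id (fun x => g (c + x))) => //.
    by apply: measurableT_comp mg _; exact: measurable_funD.
  - exact: ibound.
have bD : `|Exp P D| <= B * Exp P (fun w => `|xi i w| ^+ 3).
  rewrite (le_trans (normr_Exp P _ iD))// -ExpZ//.
  apply: le_Exp; [exact: integrableR_norm|exact: integrableRZ|move=> w].
  rewrite /D normrM exprS mulrCA ler_wpM2l// (ZE i).
  rewrite (le_trans (taylor _ _))// ler_wpM2l//.
  by rewrite -normrX ler_norm.
have bG : `|Exp P (fun w => g' (Y i w)) - Exp P (fun w => g' (Z w))| <=
    B * Exp P (fun w => `|xi i w|).
  rewrite -ExpB; [|exact: ibound|exact: ibound].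
  have iB : integrableR P (fun w => g' (Y i w) - g' (Z w)).
    by apply: integrableRB; exact: ibound.
  rewrite (le_trans (normr_Exp P _ iB))// -ExpZ; last exact: integrableR_norm.
  apply: le_Exp; [exact: integrableR_norm|exact/integrableRZ/integrableR_norm|move=> w].
  by rewrite (le_trans (g'L _ _))// (ZE i) opprD addNKr normrN.
move: ED bD bG; set a := Exp P (fun w => xi i w * g (Z w)).
set s := Exp P (fun w => xi i w ^+ 2); set u := Exp P (fun w => g' (Y i w)).
set v := Exp P (fun w => g' (Z w)) => ED bD bG.
have s0 : 0 <= s by apply: Exp_ge0 => w; exact: sqr_ge0.
have -> : a - s * v = Exp P D + s * (u - v) by rewrite ED; ring.
rewrite (le_trans (ler_normD _ _))// [leRHS]mulrDr lerD// normrM (ger0_norm s0) mulrCA.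
by rewrite ler_wpM2l.
Qed.

(** The equation turns [h] into [g' (Z w)] minus the sum of the [xi i w * g (Z w)]. By [step] each
    of these means is close to a variance times the mean of [g' (Z w)], which leaves the defect of
    the total variance from 1. *)
Lemma stein_bound : `|Exp P (fun w => h (c + \sum_i xi i w))| <=
  B * (`|1 - \sum_i Exp P (fun w => xi i w ^+ 2)| +
       \sum_i (Exp P (fun w => `|xi i w| ^+ 3) +
               Exp P (fun w => xi i w ^+ 2) * Exp P (fun w => `|xi i w|))).
Proof.
have ig i : integrableR P (fun w => xi i w * g (Z w)) by exact: imul.
have -> : (fun w => h (c + \sum_i xi i w)) =
    fun w => g' (Z w) - \sum_i xi i w * g (Z w).
  by apply/funext => w; rewrite -gg' -mulr_suml /Z; congr (_ - _ * _); ring.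
rewrite ExpB; [|exact: ibound|exact: integrableR_sum].
rewrite Exp_sum//.
set v := Exp P (fun w => g' (Z w)).
have -> : v - \sum_i Exp P (fun w => xi i w * g (Z w)) =
  v * (1 - \sum_i Exp P (fun w => xi i w ^+ 2)) -
  \sum_i (Exp P (fun w => xi i w * g (Z w)) - Exp P (fun w => xi i w ^+ 2) * v).
  by rewrite sumrB -mulr_suml; ring.
rewrite (le_trans (ler_normB _ _))// [leRHS]mulrDr lerD//.
  rewrite normrM ler_wpM2r// (le_trans (normr_Exp P _ _))//; first exact: ibound.
  rewrite -[leRHS](Exp_cst P B); apply: le_Exp => //.
    by apply/integrableR_norm; exact: ibound.
  exact: integrableR_cst.
rewrite (le_trans (ler_norm_sum _ _ _))// mulr_sumr.
by apply: ler_sum => i _; exact: step.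
Qed.

End stein_bound.

(** * Piecewise linear tests, the normal law, and passage to distribution functions *)

Section trapezoid.
Context {R : realType}.

Definition clip (t : R) : R := Num.min 1 (Num.max 0 t).

Lemma clipP (t : R) :
  [\/ t <= 0 /\ clip t = 0, (0 <= t /\ t <= 1) /\ clip t = t | 1 <= t /\ clip t = 1].
Proof.
rewrite /clip; have [t0|t0] := leP t 0.
  by apply: Or31; rewrite (min_idPr _).
by have [t1|t1] := leP 1 t; [apply: Or33|apply: Or32; split => //; split; exact: ltW].
Qed.

Lemma clip_bounds (t : R) : 0 <= clip t <= 1.
Proof. by case: (clipP t) => -[? ->]; apply/andP; split; lra. Qed.

Lemma clip_ge1 (t : R) : 1 <= t -> clip t = 1.
Proof. by case: (clipP t) => -[? ->]; lra. Qed.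

Lemma clip_le0 (t : R) : t <= 0 -> clip t = 0.
Proof. by case: (clipP t) => -[? ->]; lra. Qed.

Lemma clip_lipschitz (s t : R) : `|clip s - clip t| <= `|s - t|.
Proof.
wlog st : s t / s <= t.
  by move=> W; have [/W//|/ltW/W] := leP s t; rewrite distrC (distrC t).
rewrite [leRHS]ler0_norm ?subr_le0// ler_norml.
by case: (clipP s) => -[? ->]; case: (clipP t) => -[? ->]; apply/andP; split; lra.
Qed.

(** For [- K <= a] this is a rise from 0 to 1 on [-K-1, -K], a plateau up to [a] and a fall to 0 at
    [a']: a compactly supported Lipschitz substitute for the indicator of ]-oo, a]. *)
Definition trapezoid (K a a' x : R) : R := clip (x + K + 1) * clip ((a' - x) / (a' - a)).

Variables (K a a' : R).
Hypothesis aa' : a < a'.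

Lemma trapezoid_bounds (x : R) : 0 <= trapezoid K a a' x <= 1.
Proof.
have /andP[u0 u1] := clip_bounds (x + K + 1).
have /andP[v0 v1] := clip_bounds ((a' - x) / (a' - a)).
by rewrite /trapezoid mulr_ge0// mulr_ile1.
Qed.

Lemma trapezoid1 (x : R) : - K <= x <= a -> trapezoid K a a' x = 1.
Proof.
move=> /andP[Kx xa]; rewrite /trapezoid (clip_ge1 (x + K + 1)); last by lra.
by rewrite clip_ge1 ?mulr1// ler_pdivlMr ?subr_gt0//; lra.
Qed.

Lemma trapezoid_right (x : R) : a' <= x -> trapezoid K a a' x = 0.
Proof.
move=> ax; rewrite /trapezoid [X in _ * X]clip_le0 ?mulr0//.
by rewrite ler_pdivrMr ?subr_gt0// mul0r; lra.
Qed.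

Lemma trapezoid_left (x : R) : x <= - K - 1 -> trapezoid K a a' x = 0.
Proof. by move=> ax; rewrite /trapezoid clip_le0 ?mul0r//; lra. Qed.

(** Both factors lie in [0, 1], so in the product their Lipschitz constants 1 and [(a' - a)^-1] add
    up. *)
Lemma trapezoid_lipschitz : lipschitzR (1 + (a' - a)^-1) (trapezoid K a a').
Proof.
move=> x y; rewrite /trapezoid.
have := clip_lipschitz (x + K + 1) (y + K + 1).
have -> : x + K + 1 - (y + K + 1) = x - y by ring.
have := clip_lipschitz ((a' - x) / (a' - a)) ((a' - y) / (a' - a)).
have -> : (a' - x) / (a' - a) - (a' - y) / (a' - a) = (y - x) / (a' - a) by ring.
rewrite normrM (distrC y) [X in _ <= _ * X]gtr0_norm ?invr_gt0 ?subr_gt0//.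
have := clip_bounds (x + K + 1); have := clip_bounds ((a' - y) / (a' - a)).
set u := clip (x + K + 1); set u' := clip (y + K + 1).
set v := clip ((a' - x) / _); set v' := clip ((a' - y) / _).
move=> /andP[v0 v1] /andP[u0 u1] Hv Hu.
have -> : u * v - u' * v' = v' * (u - u') + u * (v - v') by ring.
rewrite (le_trans (ler_normD _ _))// !normrM (ger0_norm u0) (ger0_norm v0).
rewrite mulrDl mul1r lerD//.
  by rewrite (le_trans _ Hu)// ler_piMl.
by rewrite [leRHS]mulrC (le_trans _ Hv)// ler_piMl.
Qed.

Lemma trapezoid_vanishes K' : K + 1 <= K' -> a' <= K' -> 0 <= K ->
  vanishes_outside K' (trapezoid K a a').
Proof.
move=> KK' aK' K0 x; have [x0|x0] := leP 0 x.
  by rewrite ger0_norm// => Kx; rewrite trapezoid_right//; lra.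
by rewrite ltr0_norm// => Kx; rewrite trapezoid_left//; lra.
Qed.

End trapezoid.

Section normal_mean_theory.
Context {R : realType} (c : R).
Local Notation mu := (@lebesgue_measure R).
Local Notation phi := (normal_pdf c 1).
Local Notation Q := (normal_prob c 1).

Definition bounded_measurable (f : R -> R) : Prop :=
  measurable_fun setT f /\ exists B, forall x, `|f x| <= B.

Lemma bounded_measurable_integrable f : bounded_measurable f ->
  mu.-integrable setT (EFin \o (fun x => f x * phi x)).
Proof.
move=> [mf [B fB]].
apply: (@integrableMr _ _ _ mu setT measurableT f (EFin \o phi)) => //.
- by exists B; split; [exact: num_real|move=> x Bx y _ /=; exact: le_trans (fB y) (ltW Bx)].
- exact: integrable_normal_pdf.
Qed.

Lemma bounded_measurable_indic (A : set R) : measurable A -> bounded_measurable \1_A.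
Proof.
move=> mA; split; first exact: measurable_indic.
by exists 1 => x; rewrite indicE ger0_norm// lern1 leq_b1.
Qed.

Lemma bounded_measurable_trapezoid K a a' : a < a' -> bounded_measurable (trapezoid K a a' : R -> R).
Proof.
move=> aa'; split.
  apply: continuous_measurable_fun.
  exact/lipschitzR_continuous/trapezoid_lipschitz.
by exists 1 => x; have /andP[? ?] := trapezoid_bounds K a a' x; rewrite ger0_norm.
Qed.

Lemma le_normal_mean f g : bounded_measurable f -> bounded_measurable g ->
  (forall x, f x <= g x) -> normal_mean c f <= normal_mean c g.
Proof.
move=> bf bg fg; apply: le_Rintegral => //; try exact: bounded_measurable_integrable.
by move=> x _; rewrite ler_wpM2r// normal_pdf_ge0.
Qed.

Lemma normal_mean_indic (A : set R) : measurable A -> Pr Q A = normal_mean c \1_A.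
Proof.
move=> mA; transitivity (fine (\int[mu]_(x in A) (phi x)%:E)%E) => //.
rewrite integral_mkcond; congr fine; apply: eq_integral => x _.
by rewrite patchE indicE; case: ifPn => xA; rewrite ?mul1r ?mul0r.
Qed.

Lemma normal_meanD f g : bounded_measurable f -> bounded_measurable g ->
  normal_mean c (fun x => f x + g x) = normal_mean c f + normal_mean c g.
Proof.
move=> bf bg; rewrite /normal_mean -RintegralD//; try exact: bounded_measurable_integrable.
by apply: eq_Rintegral => x _; rewrite mulrDl.
Qed.

Lemma normal_meanZ r f : bounded_measurable f ->
  normal_mean c (fun x => r * f x) = r * normal_mean c f.
Proof.
move=> bf; rewrite /normal_mean -RintegralZl//; last exact: bounded_measurable_integrable.
by apply: eq_Rintegral => x _; rewrite mulrA.
Qed.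

Lemma normal_mean1 : normal_mean c (fun=> 1) = 1.
Proof.
rewrite -[RHS](_ : Pr Q setT = 1); last by rewrite /Pr [X in fine X]probability_setT.
by rewrite normal_mean_indic// indicT.
Qed.

(** Continuity from below along the intervals [-n, n]; the lower bound [K0] lets a caller impose
    further size conditions on [K]. *)
Lemma normal_tight (t K0 : R) : 0 < t -> exists2 K : R, K0 <= K & 1 - t <= Pr Q `[- K, K]%classic.
Proof.
move=> t0; pose F (n : nat) : set R := `[- (n%:R : R), n%:R]%classic.
have mF n : measurable (F n) by exact: measurable_itv.
have ndF : {homo F : n m / (n <= m)%N >-> (n <= m)%O}.
  move=> n m nm; apply/subsetPset => x; rewrite /F /= !in_itv/= => /andP[x1 x2].
  have : n%:R <= m%:R :> R by rewrite ler_nat.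
  by move=> ?; apply/andP; split; lra.
have UF : \bigcup_n F n = setT.
  rewrite -subTset => x _; have := truncnS_gt `|x|; set n := (Num.trunc _).+1 => xn.
  by exists n => //; rewrite /F/= in_itv/= -ler_norml ltW.
have cQ : Q (F n) @[n --> \oo] --> (1 : R)%:E.
  have <- : Q setT = 1%E by exact: probability_setT.
  have mU : measurable (\bigcup_n F n) by rewrite UF.
  by rewrite -UF; exact: (nondecreasing_cvg_mu (mu := Q) mF mU ndF).
have /fine_cvgP[_ /cvgrPdist_le/(_ t t0) H] := cQ.
near \oo => n.
exists n%:R.
  near: n; exact: nbhs_infty_ger.
have : `|1 - fine (Q (F n))| <= t by near: n; exact: H.
by rewrite ler_norml /= => /andP[_]; rewrite /Pr /F; lra.
Unshelve. all: by end_near. Qed.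

End normal_mean_theory.

Lemma indic_pred {R : realType} {T : Type} (p : pred T) (x : T) :
  \1_[set w | p w] x = (p x)%:R :> R.
Proof. by rewrite indicE; congr (nat_of_bool _)%:R; apply/idP/idP; rewrite inE. Qed.

Section centered_tests.
Context {R : realType} {d : nat -> measure_display}
  {T : forall k, measurableType (d k)} (P : forall k, probability (T k) R).
Variables (Z : forall k, T k -> R) (c C : R).
Arguments Z : clear implicits.
Local Notation Q := (normal_prob c 1).

Hypotheses (mZ : forall k, measurable_fun setT (Z k))
  (Z2 : \forall k \near \oo, integrableR (P k) (fun w => Z k w ^+ 2) /\
                             Exp (P k) (fun w => Z k w ^+ 2) <= C).
Hypothesis Zh : forall K L (h : R -> R), 0 <= K -> lipschitzR L h ->
  vanishes_outside K h -> normal_mean c h = 0 ->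
  (fun k => Exp (P k) (fun w => h (Z k w))) @ \oo --> 0.

Let itrap k K a a' : a < a' -> integrableR (P k) (fun w => trapezoid K a a' (Z k w)).
Proof.
move=> aa'; have [mt _] := bounded_measurable_trapezoid K _ _ aa'.
apply: (integrableR_bounded _ 1); first exact: measurableT_comp.
by move=> w; have /andP[? ?] := trapezoid_bounds K a a' (Z k w); rewrite ger0_norm.
Qed.

(* Subtracting a multiple of a wide bump makes a trapezoid a centered test
   function; by Chebyshev and the tightness of the normal law both means of the
   bump are close to 1. *)
Lemma cvg_of_centered_tests a a' eps : a < a' -> 0 < eps ->
  \forall k \near \oo,
    Pr (P k) [set w | Z k w <= a] <= Pr Q `]-oo, a']%classic + eps /\
    Pr Q `]-oo, a]%classic <= Pr (P k) [set w | Z k w <= a'] + eps.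
Proof.
(* At most four errors of size [t] accumulate in either inequality, so [eps / 8] is ample; [1 / 2]
   keeps [beta] away from 0 and yields [r <= p + 2 * t]. *)
move=> aa' e0; pose t := Num.min (1 / 2) (eps / 8).
have t0 : 0 < t by rewrite lt_min; apply/andP; split; lra.
have t12 : t <= 1 / 2 by rewrite ge_min lexx.
have te : t <= eps / 8 by rewrite ge_min lexx orbT.
(* The summand [|a'|] places [a'] below [K]; the others give [1 <= K] and [|C| / t <= K], hence the
   Chebyshev bound [|C| / K ^+ 2 <= t]. *)
have [K KK0 QK] := normal_tight c t (`|a'| + `|C| / t + 1) t0.
have C0 : 0 <= `|C| / t by rewrite divr_ge0// ltW.
have a'0 : 0 <= `|a'| by [].
have K1 : 1 <= K by lra.
have CK : `|C| / K ^+ 2 <= t.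
  rewrite ler_pdivrMr ?exprn_gt0//; last by lra.
  rewrite mulrC -ler_pdivrMr// (le_trans (_ : _ <= K))//; first by lra.
  by rewrite expr2 ler_peMr//; lra.
have aK : a' <= K by rewrite (le_trans (ler_norm a'))//; lra.
have KK1 : K < K + 1 by lra.
pose g : R -> R := trapezoid K a a'; pose B : R -> R := trapezoid K K (K + 1).
have bg : bounded_measurable g by exact: bounded_measurable_trapezoid.
have bB : bounded_measurable B by exact: bounded_measurable_trapezoid.
pose p := normal_mean c g; pose beta := normal_mean c B.
have b1 : bounded_measurable (fun=> 1 : R).
  by split => //; exists 1 => x; rewrite normr1.
have mK : measurable (`[- K, K]%classic : set R) by exact: measurable_itv.
have beta_ge : 1 - t <= beta.
  rewrite (le_trans QK)// normal_mean_indic//.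
  apply: le_normal_mean => //; first exact: bounded_measurable_indic.
  move=> x; rewrite indicE; case: (boolP (x \in _)) => [/set_mem/=|_].
    by rewrite in_itv/= => xK; rewrite /B trapezoid1.
  by have /andP[] := trapezoid_bounds K K (K + 1) x.
have beta_le : beta <= 1.
  rewrite -(normal_mean1 c); apply: le_normal_mean => // x.
  by have /andP[] := trapezoid_bounds K K (K + 1) x.
have p0 : 0 <= p.
  rewrite (_ : 0 = normal_mean c (fun=> 0)).
    apply: le_normal_mean => //; first by split => //; exists 0 => x; rewrite normr0.
    by move=> x; have /andP[] := trapezoid_bounds K a a' x.
  by rewrite (_ : (fun=> 0) = fun x => 0 * (cst 1) x) ?normal_meanZ ?mul0r//; apply/funext => x; rewrite mul0r.
have p_le : p <= Pr Q `]-oo, a']%classic.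
  rewrite normal_mean_indic//; apply: le_normal_mean => //; first exact: bounded_measurable_indic.
  move=> x; rewrite indicE; case: (boolP (x \in _)) => [_|].
    by have /andP[] := trapezoid_bounds K a a' x.
  move=> /negP H; rewrite /g trapezoid_right// leNgt; apply/negP => xa'; apply: H.
  by rewrite inE/= in_itv/= ltW.
have p1 : p <= 1 by rewrite (le_trans p_le)// Pr_le1.
have p_ge : Pr Q `]-oo, a]%classic <= p + t.
  (* Pointwise, the indicators of ]-oo, a] and [-K, K] add up to at most [g + 1], because [g] is 1
     on the intersection. *)
  suff : Pr Q `]-oo, a]%classic + Pr Q `[- K, K]%classic <= p + 1 by lra.
  rewrite !normal_mean_indic// -(normal_mean1 c) -!normal_meanD//; try exact: bounded_measurable_indic.
  apply: le_normal_mean.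
  - split; first by apply: measurable_funD; exact: measurable_indic.
    exists 2 => x; rewrite !indicE ger0_norm ?addr_ge0//.
    by rewrite (_ : 2 = 1 + 1)// lerD// lern1 leq_b1.
  - split; first by apply: measurable_funD => //; case: bg.
    exists 2 => x; have /andP[? ?] := trapezoid_bounds K a a' x.
    by rewrite ger0_norm /g; lra.
  - move=> x; have /andP[g0 g1] := trapezoid_bounds K a a' x.
    rewrite !(indic_pred (fun x => x \in Interval _ _)) !in_itv/=; case: (leP x a) => xa /=; last first.
      by rewrite add0r; case: (_ && _) => /=; rewrite /g; lra.
    case: (leP (- K) x) => Kx /=; last by rewrite addr0 /g; lra.
    by rewrite /g trapezoid1 ?Kx ?xa//; case: (x <= K) => /=; lra.
(* The multiple of the bump for which [h] has normal mean zero. *)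
pose r := p / beta.
have beta0 : 0 < beta by lra.
have r_ge : p <= r by rewrite /r ler_pdivlMr// ler_piMr.
have r_le : r <= p + 2 * t.
  rewrite /r ler_pdivrMr//.
  suff : p <= (p + 2 * t) * (1 - t) by move/le_trans; apply; rewrite ler_wpM2l//; lra.
  by nra.
pose h x := g x - r * B x.
pose K' := K + 2.
have K'0 : 0 <= K' by rewrite /K'; lra.
have hh : (fun k => Exp (P k) (fun w => h (Z k w))) @ \oo --> 0.
  apply: (Zh K' (1 + (a' - a)^-1 + `|r| * (1 + (K + 1 - K)^-1))) => //.
  - move=> x y; rewrite /h.
    have -> : g x - r * B x - (g y - r * B y) = (g x - g y) - r * (B x - B y) by ring.
    rewrite (le_trans (ler_normB _ _))// mulrDl lerD//; first exact: trapezoid_lipschitz.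
    by rewrite normrM -mulrA ler_wpM2l//; exact: trapezoid_lipschitz.
  - move=> x Kx; rewrite /h /g /B.
    rewrite (trapezoid_vanishes K _ _ _ K')//; try (rewrite /K'; lra).
    rewrite (trapezoid_vanishes K _ _ _ K')//; try (rewrite /K'; lra).
  - have -> : h = fun x => g x + (- r) * B x by apply/funext => x; rewrite /h mulNr.
    rewrite normal_meanD//.
      by rewrite normal_meanZ// /r -/p -/beta mulNr divfK ?subrr// gt_eqF.
    split; first by apply: measurable_funM => //; case: bB.
    exists `|r| => x; rewrite normrM normrN ler_piMr//.
    by have /andP[? ?] := trapezoid_bounds K K (K + 1) x; rewrite ger0_norm.
move/cvgrPdist_le : hh => /(_ t t0) hh.
near=> k.
have [iZ2 EZ2] : integrableR (P k) (fun w => Z k w ^+ 2) /\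
    Exp (P k) (fun w => Z k w ^+ 2) <= C by near: k.
have : `|0 - Exp (P k) (fun w => h (Z k w))| <= t by near: k.
have ig := itrap k K a a' aa'; have iB := itrap k K K (K + 1) KK1.
rewrite sub0r normrN /h ExpB//; last exact: integrableRZ.
rewrite ExpZ// ler_norml => /andP[H1 H2].
have Bup : Exp (P k) (fun w => B (Z k w)) <= 1.
  rewrite -[leRHS](Exp_cst (P k)); apply: le_Exp => //; first exact: integrableR_cst.
  by move=> w; have /andP[] := trapezoid_bounds K K (K + 1) (Z k w).
have CKt : (K ^+ 2)^-1 * Exp (P k) (fun w => Z k w ^+ 2) <= t.
  rewrite mulrC (le_trans _ CK)// ler_wpM2r// ?invr_ge0 ?exprn_ge0//; first by lra.
  by rewrite (le_trans EZ2)// ler_norm.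
have K20 : 0 < K ^+ 2 by rewrite exprn_gt0//; lra.
have out x : K <= `|x| -> 1 <= (K ^+ 2)^-1 * x ^+ 2.
  move=> Kx; rewrite mulrC ler_pdivlMr// mul1r -[x ^+ 2]ger0_norm ?sqr_ge0// normrX.
  by rewrite lerXn2r ?nnegrE//; lra.
have sq0 x : 0 <= (K ^+ 2)^-1 * x ^+ 2.
  by rewrite mulr_ge0// ?sqr_ge0// invr_ge0 ltW.
have Blow : 1 - t <= Exp (P k) (fun w => B (Z k w)).
  (* Chebyshev in pointwise form: where the bump is not 1, [Z ^+ 2 / K ^+ 2] is at least 1. *)
  suff : 1 <= Exp (P k) (fun w => B (Z k w) + (K ^+ 2)^-1 * Z k w ^+ 2).
    by rewrite ExpD//; [rewrite ExpZ//; lra|exact: integrableRZ].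
  rewrite -[leLHS](Exp_cst (P k)); apply: le_Exp; first exact: integrableR_cst.
    by apply: integrableRD => //; exact: integrableRZ.
  move=> w; have /andP[B0 B1] := trapezoid_bounds K K (K + 1) (Z k w).
  have [/out|] := leP K `|Z k w|; first by rewrite /B; lra.
  by move=> /ltW; rewrite ler_norml => wK; rewrite /B trapezoid1// lerDl.
have mle x : measurable [set w | Z k w <= x] by exact: measurable_le_cst.
split.
  have : Pr (P k) [set w | Z k w <= a] <=
      Exp (P k) (fun w => g (Z k w) + (K ^+ 2)^-1 * Z k w ^+ 2).
    rewrite Pr_Exp//; apply: le_Exp; first exact: integrableR_indic.
      by apply: integrableRD => //; exact: integrableRZ.
    move=> w; have /andP[g0 g1] := trapezoid_bounds K a a' (Z k w).
    rewrite (indic_pred (fun w => Z k w <= _)) /=; have [wa|wa] := leP (Z k w) a; last first.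
      by rewrite addr_ge0.
    have [/out|] := leP K `|Z k w|; first by rewrite /g /=; lra.
    move=> /ltW; rewrite ler_norml => /andP[wK _].
    by rewrite /g trapezoid1 ?wK// lerDl.
  rewrite ExpD//; last exact: integrableRZ.
  rewrite ExpZ// => H.
  have : r * Exp (P k) (fun w => B (Z k w)) <= r by rewrite ler_piMr//; lra.
  move: H1 H2 H CKt.
  set E1 := Exp _ _; set E2 := Exp _ _; set E3 := Exp _ _; set E4 := Pr _ _.
  by lra.
have : Exp (P k) (fun w => g (Z k w)) <= Pr (P k) [set w | Z k w <= a'].
  rewrite Pr_Exp//; apply: le_Exp => //; first exact: integrableR_indic.
  move=> w; have /andP[g0 g1] := trapezoid_bounds K a a' (Z k w).
  rewrite (indic_pred (fun w => Z k w <= _)) /=; have [wa|wa] := leP (Z k w) a'; first exact: g1.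
  by rewrite /g trapezoid_right// ltW.
have : p * (1 - t) <= r * Exp (P k) (fun w => B (Z k w)) by rewrite ler_pM//; lra.
have : p * t <= t by rewrite ler_piMl// ltW.
move: H1 H2 CKt.
set E1 := Exp _ _; set E2 := Exp _ _; set E4 := Pr _ _.
by lra.
Unshelve. all: by end_near. Qed.

End centered_tests.

Lemma measurable_sum_cond {R : realType} {d} {T : measurableType d} {I : finType}
    (Q : pred I) (f : I -> T -> R) : (forall i, measurable_fun setT (f i)) ->
  measurable_fun setT (fun w => \sum_(i | Q i) f i w).
Proof.
move=> mf.
have -> : (fun w => \sum_(i | Q i) f i w) = fun w => \sum_i if Q i then f i w else 0.
  by apply/funext => w; rewrite big_mkcond.
by apply: measurable_sum => i; case: (Q i).
Qed.

Section independent_sum.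
Context {R : realType} {d} {T : measurableType d} (P : probability T R).

(* Independence in the only form the proof needs: each summand against the sum
   of all the others. *)
Definition centered_independent {I : finType} (xi : I -> T -> R) : Prop :=
  [/\ forall i, integrableR P (xi i),
      forall i, integrableR P (fun w => xi i w ^+ 2),
      forall i, Exp P (xi i) = 0 &
      forall i, independent2 P (xi i) (fun w => \sum_(l | l != i) xi l w)].

(** The square of the sum splits into the squares and the products of each term with the sum of the
    others; the latter have mean zero by the leave-one-out independence. *)
Lemma centered_independent_sqr {I : finType} (xi : I -> T -> R) :
  centered_independent xi ->
  integrableR P (fun w => (\sum_i xi i w) ^+ 2) /\
  Exp P (fun w => (\sum_i xi i w) ^+ 2) = \sum_i Exp P (fun w => xi i w ^+ 2).
Proof.
move=> [i1 i2 xi0 xi_indep].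
have mxi i : measurable_fun setT (xi i) by exact: integrableR_measurable (i1 i).
pose D i w := \sum_(l | l != i) xi l w.
have mD i : measurable_fun setT (D i) by exact: measurable_sum_cond.
have iD i : integrableR P (D i) by exact: integrableR_sum.
have iX i : integrableR P (fun w => xi i w * D i w) by exact: independent2_integrableM.
have E : (fun w => (\sum_i xi i w) ^+ 2) = fun w => \sum_i (xi i w ^+ 2 + xi i w * D i w).
  apply/funext => w; rewrite expr2 mulr_suml; apply: eq_bigr => i _.
  by rewrite /D (bigD1 i)//=; ring.
rewrite E; split.
  by apply: integrableR_sum => i _; exact: integrableRD.
rewrite Exp_sum; last by move=> i _; exact: integrableRD.
apply: eq_bigr => i _; rewrite ExpD//.
by rewrite independent2_ExpM ?xi0 ?mul0r ?addr0//; exact: xi_indep.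
Qed.

End independent_sum.

Section triangular_array.
Context {R : realType} {d : nat -> measure_display}
  {T : forall k, measurableType (d k)} (P : forall k, probability (T k) R).
Variables (I : nat -> finType) (xi : forall k, I k -> T k -> R) (c : R).
Arguments xi : clear implicits.
Local Notation Q := (normal_prob c 1).

Hypotheses (xi_indep : forall k, centered_independent (P k) (xi k))
  (xi3 : forall k i, integrableR (P k) (fun w => `|xi k i w| ^+ 3))
  (xi_variance : (fun k => \sum_i Exp (P k) (fun w => xi k i w ^+ 2)) @ \oo --> (1 : R))
  (xi_lyapunov : (fun k => \sum_i (Exp (P k) (fun w => `|xi k i w| ^+ 3) +
      Exp (P k) (fun w => xi k i w ^+ 2) * Exp (P k) (fun w => `|xi k i w|)))
    @ \oo --> (0 : R)).

Lemma triangular_clt a a' eps : a < a' -> 0 < eps ->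
  \forall k \near \oo,
    Pr (P k) [set w | c + \sum_i xi k i w <= a] <= Pr Q `]-oo, a']%classic + eps /\
    Pr Q `]-oo, a]%classic <= Pr (P k) [set w | c + \sum_i xi k i w <= a'] + eps.
Proof.
have mxi k i : measurable_fun setT (xi k i).
  by have [+ _ _ _] := xi_indep k => /(_ i)/integrableR_measurable.
(* (c + s)^2 <= 2 c^2 + 2 s^2, and the second moment of the sum is eventually at most 2 because its
   limit is 1. *)
apply: (cvg_of_centered_tests P (fun k w => c + \sum_i xi k i w) c (2 * c ^+ 2 + 4)).
- by move=> k; apply: measurable_funD => //; exact: measurable_sum.
- near=> k.
  have [is2 Es2] := centered_independent_sqr _ _ (xi_indep k).
  have i1 : integrableR (P k) (fun w => 2 * c ^+ 2 + 2 * (\sum_i xi k i w) ^+ 2).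
    by apply: integrableRD; [exact: integrableR_cst|exact: integrableRZ].
  have le w : (c + \sum_i xi k i w) ^+ 2 <= 2 * c ^+ 2 + 2 * (\sum_i xi k i w) ^+ 2.
    have := sqr_ge0 (c - \sum_i xi k i w); nra.
  have i2 : integrableR (P k) (fun w => (c + \sum_i xi k i w) ^+ 2).
    apply: integrableR_le i1 => [|w]; last by rewrite ger0_norm ?sqr_ge0.
    apply: measurable_funX; apply: measurable_funD => //; exact: measurable_sum.
  split => //; apply: (le_trans (le_Exp _ _ _ i2 i1 le)).
  rewrite ExpD; [|exact: integrableR_cst|exact: integrableRZ].
  rewrite Exp_cst ExpZ// Es2 lerD2l.
  suff : \sum_i Exp (P k) (fun w => xi k i w ^+ 2) <= 2 by lra.
  by near: k; apply: cvgr_le xi_variance _ _; lra.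
- move=> K L h K0 hL hK h0.
  have [g [g' [B [gc dg gg' B0 [gB g'B g'L]]]]] := stein_solution c K L h K0 hL hK h0.
  apply/cvgrPdist_le => eps0 eps00.
  have cb : (fun k => B * (`|1 - \sum_i Exp (P k) (fun w => xi k i w ^+ 2)| +
      \sum_i (Exp (P k) (fun w => `|xi k i w| ^+ 3) +
      Exp (P k) (fun w => xi k i w ^+ 2) * Exp (P k) (fun w => `|xi k i w|)))) @ \oo --> (0 : R).
    have c1 : (fun k => 1 - \sum_i Exp (P k) (fun w => xi k i w ^+ 2)) @ \oo --> (0 : R).
      by have := cvgB (cvg_cst (1 : R)) xi_variance; rewrite subrr; exact.
    have := cvgM (cvg_cst (B : R)) (cvgD (cvg_norm c1) xi_lyapunov).
    by rewrite normr0 addr0 mulr0; exact.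
  near=> k; rewrite sub0r normrN.
  have [i1 i2 x0 ind] := xi_indep k.
  apply: (le_trans (stein_bound (P k) c B (xi k) h g g' _ i1 i2 _ x0 ind gc dg gg' B0 gB g'B g'L)) => //.
  by near: k; apply: cvgr_le cb _ _.
Unshelve. all: by end_near. Qed.

End triangular_array.

(** * Moments *)

Section fourth_moments.
Context {R : realType} {d} {T : measurableType d} (P : probability T R).
Implicit Types f g : T -> R.

Definition finite_fourth f := measurable_fun setT f /\ integrableR P (fun w => f w ^+ 4).

(** The bounds by [1 + x ^+ 4] replace moment interpolation: only uniform boundedness of the lower
    moments is needed later, not sharp constants. *)
Lemma normr_le1X4 (x : R) : `|x| <= 1 + x ^+ 4.
Proof.
have := sqr_ge0 (x ^+ 2 - 1); have := sqr_ge0 (x - 1); have := sqr_ge0 (x + 1).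
by rewrite ler_norml => *; apply/andP; split; nra.
Qed.

Lemma sqr_le1X4 (x : R) : x ^+ 2 <= 1 + x ^+ 4.
Proof. by have := sqr_ge0 (x ^+ 2 - 1); have := sqr_ge0 x; nra. Qed.

Lemma cube_le1X4 (x : R) : `|x| ^+ 3 <= 1 + x ^+ 4.
Proof.
have -> : x ^+ 4 = `|x| ^+ 4 by rewrite -normrX ger0_norm// exprn_even_ge0.
have := normr_ge0 x; move: `|x| => y y0.
have [y1|y1] := leP y 1.
  by rewrite (le_trans (exprn_ile1 _ y0 y1))// lerDl exprn_ge0.
by rewrite -[leLHS]add0r lerD// ler_eXn2l// ltW.
Qed.

Let le1X4_integrable f g : finite_fourth f -> measurable_fun setT g ->
  (forall w, `|g w| <= 1 + f w ^+ 4) -> integrableR P g.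
Proof.
move=> [_ f4] mg gf; apply: (integrableR_le P (fun w => 1 + f w ^+ 4)) => //.
by apply: integrableRD => //; exact: integrableR_cst.
Qed.

Lemma finite_fourth1 f : finite_fourth f -> integrableR P f.
Proof. by move=> f4; apply: (le1X4_integrable f) => // [|w]; [case: f4|exact: normr_le1X4]. Qed.

Lemma finite_fourth2 f : finite_fourth f -> integrableR P (fun w => f w ^+ 2).
Proof.
move=> f4; apply: (le1X4_integrable f) => // [|w].
  by apply: measurable_funX; case: f4.
by rewrite ger0_norm ?sqr_ge0//; exact: sqr_le1X4.
Qed.

Lemma finite_fourth3 f : finite_fourth f -> integrableR P (fun w => `|f w| ^+ 3).
Proof.
move=> f4; apply: (le1X4_integrable f) => // [|w].
  by apply: measurable_funX; apply: measurableT_comp => //; case: f4.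
by rewrite ger0_norm ?exprn_ge0//; exact: cube_le1X4.
Qed.

Lemma Exp_abs_le1X4 f : finite_fourth f ->
  Exp P (fun w => `|f w|) <= 1 + Exp P (fun w => f w ^+ 4).
Proof.
move=> f4; have f1 := finite_fourth1 _ f4; case: f4 => mf f4.
rewrite -[X in X + _](Exp_cst P) -ExpD//; last exact: integrableR_cst.
apply: le_Exp; [exact: integrableR_norm|by apply: integrableRD => //; exact: integrableR_cst|].
by move=> w; exact: normr_le1X4.
Qed.

Lemma Exp_sqr_le1X4 f : finite_fourth f ->
  Exp P (fun w => f w ^+ 2) <= 1 + Exp P (fun w => f w ^+ 4).
Proof.
move=> f4; have f2 := finite_fourth2 _ f4; case: f4 => mf f4.
rewrite -[X in X + _](Exp_cst P) -ExpD//; last exact: integrableR_cst.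
apply: le_Exp => //; first by apply: integrableRD => //; exact: integrableR_cst.
by move=> w; exact: sqr_le1X4.
Qed.

Lemma Exp_cube_le1X4 f : finite_fourth f ->
  Exp P (fun w => `|f w| ^+ 3) <= 1 + Exp P (fun w => f w ^+ 4).
Proof.
move=> f4; have f3 := finite_fourth3 _ f4; case: f4 => mf f4.
rewrite -[X in X + _](Exp_cst P) -ExpD//; last exact: integrableR_cst.
apply: le_Exp => //; first by apply: integrableRD => //; exact: integrableR_cst.
by move=> w; exact: cube_le1X4.
Qed.

(** (u + v)^2 <= 2 (u^2 + v^2) used twice, whence 8 = 2^2 * 2. *)
Lemma X4D_le (x y : R) : (x + y) ^+ 4 <= 8 * (x ^+ 4 + y ^+ 4).
Proof.
have h (u v : R) : (u + v) ^+ 2 <= 2 * (u ^+ 2 + v ^+ 2) by have := sqr_ge0 (u - v); nra.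
have -> : (x + y) ^+ 4 = ((x + y) ^+ 2) ^+ 2 by ring.
apply: (@le_trans _ _ ((2 * (x ^+ 2 + y ^+ 2)) ^+ 2)).
  by rewrite lerXn2r ?nnegrE ?sqr_ge0//; have := sqr_ge0 x; have := sqr_ge0 y; lra.
by have := h (x ^+ 2) (y ^+ 2); rewrite -!exprM exprMn; lra.
Qed.

Lemma finite_fourthD f g : finite_fourth f -> finite_fourth g ->
  finite_fourth (fun w => f w + g w) /\ Exp P (fun w => (f w + g w) ^+ 4) <=
    8 * (Exp P (fun w => f w ^+ 4) + Exp P (fun w => g w ^+ 4)).
Proof.
move=> [mf f4] [mg g4].
have i : integrableR P (fun w => 8 * (f w ^+ 4 + g w ^+ 4)).
  by apply: integrableRZ; exact: integrableRD.
have j : finite_fourth (fun w => f w + g w).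
  split; first exact: measurable_funD.
  apply: integrableR_le i => [|w]; first by apply: measurable_funX; exact: measurable_funD.
  by rewrite ger0_norm ?exprn_even_ge0//; exact: X4D_le.
split => //; rewrite -ExpD// -ExpZ//; last exact: integrableRD.
by apply: le_Exp => //; [case: j|move=> w; exact: X4D_le].
Qed.

Lemma finite_fourthM f g : finite_fourth f -> finite_fourth g -> independent2 P f g ->
  finite_fourth (fun w => f w * g w) /\ Exp P (fun w => (f w * g w) ^+ 4) =
    Exp P (fun w => f w ^+ 4) * Exp P (fun w => g w ^+ 4).
Proof.
move=> [mf f4] [mg g4] fg.
have fg4 : independent2 P (fun w => f w ^+ 4) (fun w => g w ^+ 4).
  exact: (independent2_comp P (fun x => x ^+ 4) (fun x => x ^+ 4)).
have E : (fun w => (f w * g w) ^+ 4) = fun w => f w ^+ 4 * g w ^+ 4.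
  by apply/funext => w; rewrite exprMn.
have mf4 := integrableR_measurable P f4; have mg4 := integrableR_measurable P g4.
rewrite /finite_fourth E; split; last exact: independent2_ExpM.
by split; [exact: measurable_funM|exact: independent2_integrableM].
Qed.

Lemma finite_fourthZ (c : R) f : finite_fourth f -> finite_fourth (fun w => c * f w).
Proof.
move=> [mf f4]; split; first exact: measurable_funM.
have -> : (fun w => (c * f w) ^+ 4) = fun w => c ^+ 4 * f w ^+ 4.
  by apply/funext => w; rewrite exprMn.
exact: integrableRZ.
Qed.

Lemma finite_fourth_integrableM f g : finite_fourth f -> finite_fourth g ->
  integrableR P (fun w => f w * g w).
Proof.
move=> f4 g4.
apply: (integrableR_le P (fun w => f w ^+ 2 + g w ^+ 2)).
- by apply: measurable_funM; [case: f4|case: g4].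
- move=> w; rewrite ler_norml; have := sqr_ge0 (f w - g w); have := sqr_ge0 (f w + g w).
  by move=> *; apply/andP; split; nra.
- by apply: integrableRD; exact: finite_fourth2.
Qed.

End fourth_moments.

(* Bounds for the fourth moments of sums and of sums of products of pairs, from
   [S (i :: s) = X i + S s], [G (i :: s) = G s + X i * S s] and
   [(x + y)^4 <= 8 (x^4 + y^4)]. *)
Fixpoint sum_fourth {R : realType} (q : R) (n : nat) : R :=
  if n is n'.+1 then 8 * (sum_fourth q n' + q) else 0.

Fixpoint pair_fourth {R : realType} (q : R) (n : nat) : R :=
  if n is n'.+1 then 8 * (pair_fourth q n' + q * sum_fourth q n') else 0.

Lemma sum_fourth_ge0 {R : realType} (q : R) n : 0 <= q -> 0 <= sum_fourth q n.
Proof. by move=> q0; elim: n => //= n IH; lra. Qed.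

Lemma pair_fourth_ge0 {R : realType} (q : R) n : 0 <= q -> 0 <= pair_fourth q n.
Proof. by move=> q0; elim: n => //= n IH; have := sum_fourth_ge0 q n q0; nra. Qed.

Section list_moments.
Context {R : realType} {d} {T : measurableType d} (P : probability T R).
Context {I : finType} (X : I -> {RV P >-> R}).
Hypothesis indepX : mutually_independent P X.

Lemma determined_by_comp (F : {set I}) (u : R -> R) (f : T -> R) :
  measurable_fun setT u -> determined_by P X F f ->
  determined_by P X F (fun w => u (f w)).
Proof. by move=> mu mf; exact: measurableT_comp mu mf. Qed.

Lemma determined_byD (F : {set I}) (f g : T -> R) :
  determined_by P X F f -> determined_by P X F g ->
  determined_by P X F (fun w => f w + g w).
Proof. by move=> mf mg; exact: measurable_funD mf mg. Qed.

Lemma determined_byM (F : {set I}) (f g : T -> R) :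
  determined_by P X F f -> determined_by P X F g ->
  determined_by P X F (fun w => f w * g w).
Proof. by move=> mf mg; exact: measurable_funM mf mg. Qed.

Lemma determined_by_cst (F : {set I}) (c : R) : determined_by P X F (fun=> c).
Proof. exact: measurable_cst. Qed.

Lemma determined_by_sum (F : {set I}) (J : Type) (s : seq J) (Q : pred J) (f : J -> T -> R) :
  (forall j, Q j -> determined_by P X F (f j)) ->
  determined_by P X F (fun w => \sum_(j <- s | Q j) f j w).
Proof.
move=> mf; elim: s => [|i s IH].
  have -> : (fun w => \sum_(i <- [::] | Q i) f i w) = fun=> 0.
    by apply/funext => w; rewrite big_nil.
  exact: determined_by_cst.
have -> : (fun w => \sum_(j <- i :: s | Q j) f j w) = fun w =>
    if Q i then f i w + \sum_(j <- s | Q j) f j w else \sum_(j <- s | Q j) f j w.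
  by apply/funext => w; rewrite big_cons.
by case Qi : (Q i) => //; apply: determined_byD => //; exact: mf.
Qed.

(** The sum of the other functions depends only on coordinates outside block [j], a set disjoint
    from the block. *)
Lemma blocks_independent (J : finType) (blk : I -> J) (f : J -> T -> R) :
  (forall j, determined_by P X [set x | blk x == j]%SET (f j)) ->
  forall j, independent2 P (f j) (fun w => \sum_(l | l != j) f l w).
Proof.
move=> df j.
apply: (determined_by_independent P X indepX [set x | blk x == j]%SET [set x | blk x != j]%SET) => //.
  by rewrite -setI_eq0; apply/eqP/setP => x; rewrite !finset.inE; case: eqP.
apply: determined_by_sum => l lj; apply: determined_by_sub (df l).
by apply/fintype.subsetP => x; rewrite !finset.inE => /eqP ->.
Qed.

Definition list_sum (s : seq I) (w : T) : R := \sum_(i <- s) X i w.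
(** The second elementary symmetric polynomial of the listed variables, through the identity that
    avoids ordering the indices. *)
Definition list_pair (s : seq I) (w : T) : R :=
  ((list_sum s w) ^+ 2 - \sum_(i <- s) X i w ^+ 2) / 2.

Lemma determined_by_list_sum (F : {set I}) s : (forall i, i \in s -> i \in F) ->
  determined_by P X F (list_sum s).
Proof.
move=> sF; have -> : list_sum s = fun w => \sum_(i <- s | i \in s) X i w.
  by apply/funext => w; rewrite /list_sum big_seq.
by apply: determined_by_sum => i /sF; exact: determined_by_coord.
Qed.

Lemma determined_by_list_pair (F : {set I}) s : (forall i, i \in s -> i \in F) ->
  determined_by P X F (list_pair s).
Proof.
move=> sF; apply: determined_byM; last exact: determined_by_cst.
apply: determined_byD.
  by apply: (determined_by_comp F (fun x => x ^+ 2)) => //; exact: determined_by_list_sum.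
apply: (determined_by_comp F -%R) => //.
have -> : (fun w => \sum_(i <- s) X i w ^+ 2) = fun w => \sum_(i <- s | i \in s) X i w ^+ 2.
  by apply/funext => w; rewrite big_seq.
apply: determined_by_sum => i /sF iF.
by apply: (determined_by_comp F (fun x => x ^+ 2)) => //; exact: determined_by_coord.
Qed.

Variables (v q : R).

(** Induction on the list. [uniq] makes the head independent of everything built from the tail, and
    every cross term contains the centered head to the first power. Sums and pairs go together
    because the recursion for pairs involves the sum of the tail. *)
Lemma list_moments s : uniq s -> 0 <= q ->
  (forall i, i \in s -> [/\ finite_fourth P (X i), Exp P (X i) = 0,
     Exp P (fun w => X i w ^+ 2) = v & Exp P (fun w => X i w ^+ 4) <= q]) ->
  [/\ finite_fourth P (list_sum s), Exp P (list_sum s) = 0,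
      Exp P (fun w => list_sum s w ^+ 2) = (size s)%:R * v &
      Exp P (fun w => list_sum s w ^+ 4) <= sum_fourth q (size s)] /\
  [/\ finite_fourth P (list_pair s), Exp P (list_pair s) = 0,
      Exp P (fun w => list_pair s w ^+ 2) = v ^+ 2 * ((size s)%:R * ((size s)%:R - 1) / 2) &
      Exp P (fun w => list_pair s w ^+ 4) <= pair_fourth q (size s)].
Proof.
move=> + q0; elim: s => [_ _|i s IH /= /andP[si us] H].
  have -> : list_sum [::] = fun=> 0 by apply/funext => w; rewrite /list_sum big_nil.
  have -> : list_pair [::] = fun=> 0.
    by apply/funext => w; rewrite /list_pair /list_sum !big_nil expr0n subrr mul0r.
  have F0 : finite_fourth P (fun=> 0).
    by split => //; rewrite expr0n; exact: integrableR_cst.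
  by rewrite !expr0n/= !Exp_cst !mul0r mulr0.
have [[S4 S0 SV Sq] [G4 G0 GV Gq]] := IH us (fun j js => H j (mem_behead (s := i :: s) js)).
have [X4 X0 XV Xq] := H i (mem_head i s).
have -> : list_sum (i :: s) = fun w => X i w + list_sum s w.
  by apply/funext => w; rewrite /list_sum big_cons.
have -> : list_pair (i :: s) = fun w => list_pair s w + X i w * list_sum s w.
  by apply/funext => w; rewrite /list_pair /list_sum !big_cons; field.
pose F := [set x in s]%SET.
have dis : [disjoint [set i]%SET & F]%B by rewrite disjoints1 finset.inE.
have dX : determined_by P X [set i]%SET (X i).
  by apply: determined_by_coord; rewrite finset.inE.
have dS : determined_by P X F (list_sum s).
  by apply: determined_by_list_sum => j; rewrite finset.inE.
have dG : determined_by P X F (list_pair s).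
  by apply: determined_by_list_pair => j; rewrite finset.inE.
have ind f g : determined_by P X [set i]%SET f -> determined_by P X F g -> independent2 P f g.
  exact: determined_by_independent.
have indXS := ind _ _ dX dS.
have [XS4 XSE] := finite_fourthM _ _ _ X4 S4 indXS.
have [A4 AE] := finite_fourthD _ _ _ X4 S4.
have [B4 BE] := finite_fourthD _ _ _ G4 XS4.
have iX := finite_fourth1 _ _ X4; have iS := finite_fourth1 _ _ S4.
have iX2 := finite_fourth2 _ _ X4; have iS2 := finite_fourth2 _ _ S4.
have mX : measurable_fun setT (X i) by case: X4.
have mS : measurable_fun setT (list_sum s) by case: S4.
have mG : measurable_fun setT (list_pair s) by case: G4.
have EXS : Exp P (fun w => X i w * list_sum s w) = 0.
  by rewrite independent2_ExpM// X0 mul0r.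
have iXS := finite_fourth1 _ _ XS4.
have ind2 : independent2 P (fun w => X i w ^+ 2) (fun w => list_sum s w ^+ 2).
  by apply: ind; exact: (determined_by_comp _ (fun x => x ^+ 2)).
have iXS2 : integrableR P (fun w => X i w ^+ 2 * list_sum s w ^+ 2).
  by apply: independent2_integrableM => //; exact: measurable_funX.
have iGS : integrableR P (fun w => list_pair s w * list_sum s w).
  exact: finite_fourth_integrableM.
have indG : independent2 P (X i) (fun w => list_pair s w * list_sum s w).
  by apply: ind => //; exact: determined_byM.
have mGS : measurable_fun setT (fun w => list_pair s w * list_sum s w).
  exact: measurable_funM.
have iXGS : integrableR P (fun w => X i w * (list_pair s w * list_sum s w)).
  exact: independent2_integrableM.
split; split => //.
- by rewrite ExpD// X0 S0 addr0.
- have -> : (fun w => (X i w + list_sum s w) ^+ 2) =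
      fun w => (X i w ^+ 2 + list_sum s w ^+ 2) + 2 * (X i w * list_sum s w).
    by apply/funext => w; ring.
  rewrite ExpD//; [|exact: integrableRD|exact: integrableRZ].
  by rewrite ExpD// ExpZ// EXS SV XV -natr1; ring.
- by rewrite (le_trans AE)// ler_wpM2l// addrC lerD.
- by rewrite ExpD// ?EXS ?addr0//; exact: finite_fourth1 G4.
- have -> : (fun w => (list_pair s w + X i w * list_sum s w) ^+ 2) =
      fun w => (list_pair s w ^+ 2 + X i w ^+ 2 * list_sum s w ^+ 2) +
               2 * (X i w * (list_pair s w * list_sum s w)).
    by apply/funext => w; ring.
  have iG2 := finite_fourth2 _ _ G4.
  rewrite ExpD//; [|exact: integrableRD|exact: integrableRZ].
  rewrite ExpD// ExpZ// independent2_ExpM//; try exact: measurable_funX.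
  by rewrite [X in _ + 2 * X]independent2_ExpM// X0 XV SV GV mul0r -natr1; field.
- rewrite (le_trans BE)// ler_wpM2l// lerD// XSE ler_pM//.
  + by apply: Exp_ge0 => w; exact: exprn_even_ge0.
  + by apply: Exp_ge0 => w; exact: exprn_even_ge0.
Qed.

End list_moments.

(** * Algebra of the statistics *)

Lemma sum_ltn_sym {R : realType} n (f : 'I_n -> 'I_n -> R) :
  (forall i j, f i j = f j i) ->
  \sum_(i < n) \sum_(j < n | (i < j)%N) f i j = (\sum_(i < n) \sum_j f i j - \sum_(i < n) f i i) / 2.
Proof.
move=> fC.
have gt_lt : \sum_(i < n) \sum_(j < n | (j < i)%N) f i j = \sum_(i < n) \sum_(j < n | (i < j)%N) f i j.
  under eq_bigr do rewrite big_mkcond; rewrite exchange_big/=.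
  apply: eq_bigr => i _; rewrite [RHS]big_mkcond; apply: eq_bigr => j _.
  by rewrite fC.
have -> : \sum_(i < n) \sum_j f i j =
    \sum_(i < n) \sum_(j < n | (i < j)%N) f i j + \sum_(i < n) \sum_(j < n | (j < i)%N) f i j + \sum_(i < n) f i i.
  rewrite -!big_split/=; apply: eq_bigr => i _.
  rewrite (bigD1 i)//= addrC; congr (_ + _).
  rewrite (bigID (fun j : 'I_n => (i < j)%N))/=; congr (_ + _); apply: eq_bigl => j.
    by rewrite andb_idl// => ij; rewrite -val_eqE/= gtn_eqF.
  by rewrite -val_eqE/= -leqNgt ltn_neqAle.
by rewrite gt_lt; field.
Qed.

Lemma bin2R {R : realType} n : ('C(n, 2))%:R = n%:R * (n%:R - 1) / 2 :> R.
Proof.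
case: n => [|n]; first by rewrite bin0n !mul0r.
have : (2 * 'C(n.+1, 2) = n.+1 * n)%N by rewrite -(mul_bin_diag n.+1 1) bin1.
move=> /(congr1 (fun x => x%:R : R)); rewrite !natrM => E.
apply: (mulfI (_ : 2%:R != 0 :> R)); first by rewrite pnatr_eq0.
by rewrite E -natr1; field.
Qed.

Section statistics.
Context {R : realType} (k : nat) (m : 'I_k -> nat) (m2 : forall i, (2 <= m i)%N).
Variables (y x : forall i : 'I_k, 'I_(m i) -> R) (t : 'I_k -> R).
Arguments y : clear implicits.
Arguments x : clear implicits.
Hypothesis yE : forall i j, y i j = t i + x i j.
Local Notation n := (nobs m).
Let S i := \sum_j x i j.
Let q i := \sum_j x i j ^+ 2.
Let mR i : R := (m i)%:R.

Let m_ge2 i : 2 <= mR i. Proof. by rewrite ler_nat. Qed.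

Let m_neq0 i : mR i != 0. Proof. by rewrite gt_eqF//; have := m_ge2 i; lra. Qed.

Let m1_neq0 i : mR i - 1 != 0. Proof. by rewrite gt_eqF//; have := m_ge2 i; lra. Qed.

Let n_ge2 (i : 'I_k) : 2 <= n%:R :> R.
Proof.
by rewrite ler_nat /nobs (bigD1 i)//= (leq_trans (m2 i))// leq_addr.
Qed.

Let mE i : \sum_(j < m i) (1 : R) = mR i. Proof. by rewrite sumr_const card_ord. Qed.

(** The offset [t i] cancels within a treatment and may depend on [i]: the denominator is read with
    offset mu + b_i and sample e_ij. The between-treatment statistics need a common offset, and the
    numerator is read with offset mu and sample b_i + e_ij. *)
Lemma UwithinE i : Uwithin y i = (mR i * q i - S i ^+ 2) / (mR i * (mR i - 1)).
Proof.
have m2i := m_ge2 i; rewrite /Uwithin sum_ltn_sym; last first.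
  by move=> j j'; rewrite -[in LHS]sqrrN opprB.
have -> : \sum_j (y i j - y i j) ^+ 2 / 2 = 0.
  by rewrite big1// => j _; rewrite subrr expr0n/= mul0r.
have -> : \sum_j \sum_j' (y i j - y i j') ^+ 2 / 2 = mR i * q i - S i ^+ 2.
  under eq_bigr => j _.
    under eq_bigr => j' _.
      rewrite !yE (_ : _ / 2 = x i j ^+ 2 / 2 * 1 + x i j' ^+ 2 / 2 - x i j * x i j'); last by field.
      over.
    rewrite sumrB big_split/= -!mulr_sumr -mulr_suml mE.
    over.
  by rewrite sumrB big_split/= -!mulr_suml sumr_const card_ord -mulr_natr /S /q /mR; field.
by rewrite bin2R -/(mR i); field; rewrite m1_neq0 m_neq0.
Qed.

Lemma WstatE : Wstat y = \sum_i (mR i * q i - S i ^+ 2) / (mR i - 1) / n%:R.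
Proof.
apply: eq_bigr => i _; rewrite UwithinE -/(mR i) [RHS]mulrC !invfM.
by have := m_neq0 i; rewrite -/(mR i) => m0; field; rewrite m1_neq0 ?m_neq0 gt_eqF//; have := n_ge2 i; lra.
Qed.

Hypothesis tE : forall i i', t i = t i'.

Lemma UbetweenE i i' :
  Ubetween y i i' = (mR i' * q i + mR i * q i' - 2 * S i * S i') / (2 * (mR i * mR i')).
Proof.
rewrite /Ubetween natrM -/(mR i) -/(mR i').
have -> : \sum_j \sum_j' (y i j - y i' j') ^+ 2 / 2 =
    (mR i' * q i + mR i * q i' - 2 * S i * S i') / 2.
  under eq_bigr => j _.
    under eq_bigr => j' _.
      rewrite !yE (tE i i') (_ : _ / 2 = x i j ^+ 2 / 2 * 1 + x i' j' ^+ 2 / 2 - x i j * x i' j'); last by field.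
      over.
    rewrite sumrB big_split/= -!mulr_sumr -mulr_suml mE.
    over.
  by rewrite sumrB big_split/= -!mulr_suml sumr_const card_ord -mulr_natr /S /q /mR; field.
by field; rewrite !m_neq0.
Qed.

Let V i := (S i ^+ 2 - q i) / 2.

(** In each pair of treatments the squares of single observations combine with the within statistics
    into [V], leaving the symmetric kernel [f]. Summing over all pairs gives the factor n, and
    removing the diagonal turns it into n - m_i. *)
Lemma BstatE : ('C(n, 2))%:R * Bstat y =
  \sum_i (n%:R - mR i) / (mR i - 1) * V i -
  ((\sum_i S i) ^+ 2 - \sum_i S i ^+ 2) / 2.
Proof.
pose f i i' := mR i' * (V i / (mR i - 1)) + mR i * (V i' / (mR i' - 1)) - S i * S i'.
have -> : ('C(n, 2))%:R * Bstat y = \sum_(i < k) \sum_(i' < k | (i < i')%N) f i i'.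
  rewrite /Bstat mulr_sumr; apply: eq_bigr => i _; rewrite mulr_sumr; apply: eq_bigr => i' _.
  rewrite UbetweenE !UwithinE bin2R natrM -/(mR i) -/(mR i') /f /V.
  have n2 := n_ge2 i.
  have n0 : n%:R != 0 :> R by rewrite gt_eqF//; lra.
  have n1 : n%:R - 1 != 0 :> R by rewrite gt_eqF//; lra.
  by field; rewrite n0 n1 !m1_neq0 !m_neq0.
rewrite sum_ltn_sym; last by move=> i i'; rewrite /f; ring.
have nE : n%:R = \sum_i mR i by rewrite /nobs natr_sum.
have -> : \sum_i \sum_i' f i i' =
    2 * n%:R * (\sum_i V i / (mR i - 1)) - (\sum_i S i) ^+ 2.
  under eq_bigr do rewrite sumrB big_split/= -mulr_suml -!mulr_sumr.
  by rewrite sumrB big_split/= -!mulr_sumr -!mulr_suml -nE; ring.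
have -> : \sum_i f i i = \sum_i (2 * (mR i * (V i / (mR i - 1))) - S i ^+ 2).
  by apply: eq_bigr => i _; rewrite /f; ring.
have -> : \sum_i (n%:R - mR i) / (mR i - 1) * V i =
    n%:R * (\sum_i V i / (mR i - 1)) - \sum_i mR i * (V i / (mR i - 1)).
  by rewrite mulr_sumr -sumrB; apply: eq_bigr => i _; ring.
by rewrite sumrB -mulr_sumr; field.
Qed.

End statistics.

Lemma sum_tagnat {R : realType} k (m : 'I_k -> nat) (f : 'I_k -> R) :
  \sum_(r < nobs m) f (tagnat.sig1 r) = \sum_i (m i)%:R * f i.
Proof.
transitivity (\sum_(p : {i : 'I_k & 'I_(m i)}) f (tag p)).
  by rewrite (reindex (@tagnat.sig _ m))//; exact: tagnat.sig_bij_on.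
rewrite -(sig_big_dep (fun _ => true) (fun _ _ => true) (fun i _ => f i))/=.
by apply: eq_bigr => i _; rewrite sumr_const card_ord mulr_natl.
Qed.

(** The squared weight depends only on the two treatments: a_i^2 for each of the C(m_i, 2) pairs
    within treatment i, and 1 for every mixed pair. *)
Lemma MstatE {R : realType} k (m : 'I_k -> nat) : (forall i, (2 <= m i)%N) ->
  Mstat R m = \sum_i (((nobs m)%:R - (m i)%:R) / ((m i)%:R - 1)) ^+ 2 *
                ((m i)%:R * ((m i)%:R - 1) / 2) +
              ((nobs m)%:R ^+ 2 - \sum_i (m i)%:R ^+ 2) / 2.
Proof.
move=> m2; set n := nobs m.
pose a i : R := (n%:R - (m i)%:R) / ((m i)%:R - 1).
pose g (i i' : 'I_k) : R := if i == i' then a i ^+ 2 else 1.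
have gE (r s : 'I_n) : eta R r s ^+ 2 = g (tagnat.sig1 r) (tagnat.sig1 s).
  by rewrite /eta /g; case: ifP => // _; rewrite sqrrN expr1n.
rewrite /Mstat sum_ltn_sym; last first.
  move=> r s; rewrite !gE /g [in RHS]eq_sym; case: eqP => // -> //.
under eq_bigr do under eq_bigr do rewrite gE.
under [X in _ - X]eq_bigr do rewrite gE.
under eq_bigr do rewrite (sum_tagnat _ m (g _)).
rewrite (sum_tagnat _ m (fun i => \sum_i' (m i')%:R * g i i')).
rewrite (sum_tagnat _ m (fun i => g i i)).
have -> : \sum_i (m i)%:R * (\sum_i' (m i')%:R * g i i') =
    \sum_i (m i)%:R * ((m i)%:R * a i ^+ 2 + (n%:R - (m i)%:R)).
  apply: eq_bigr => i _; congr (_ * _); rewrite (bigD1 i)//= /g eqxx; congr (_ + _).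
  rewrite /n /nobs natr_sum [in RHS](bigD1 i)//= addrAC subrr add0r.
  by apply: eq_bigr => i' /negPf; rewrite eq_sym => ->; rewrite mulr1.
rewrite -sumrB mulr_suml.
have -> : n%:R ^+ 2 = \sum_i (m i)%:R * n%:R :> R by rewrite -mulr_suml -natr_sum expr2.
rewrite -sumrB mulr_suml -big_split/=; apply: eq_bigr => i _.
by rewrite /g eqxx /a; ring.
Qed.

(** * The random effects model *)

(** Makes a bound depending on the treatment size uniform over the sizes up to [N] without any
    monotonicity. *)
Lemma ler_prefix_sum {R : realType} (u : nat -> R) N n : (forall i, 0 <= u i) ->
  (n <= N)%N -> u n <= \sum_(i < N.+1) u i.
Proof.
move=> u0 nN; rewrite (bigD1 (Ordinal (_ : n < N.+1)%N))//= lerDl.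
exact: sumr_ge0.
Qed.

Section blocks.
Context {R : realType} {d} {T : measurableType d} (P : probability T R).
Context (k : nat) (m : 'I_k -> nat) (b : 'I_k -> {RV P >-> R}).
Variable e : forall i : 'I_k, 'I_(m i) -> {RV P >-> R}.
Arguments e : clear implicits.
Variables (mu tau beta v q : R) (N : nat).
Local Notation I := ('I_k + {i : 'I_k & 'I_(m i)})%type.
Local Notation X := (effects_and_errors b e).
Local Notation n := (nobs m).

Hypotheses (m2N : forall i, (2 <= m i <= N)%N) (indep : mutually_independent P X)
  (b4 : forall i, finite_fourth P (b i)) (b0 : forall i, Exp P (b i) = 0)
  (b_var : forall i, Exp P (fun w => b i w ^+ 2) = tau)
  (b_beta : forall i, Exp P (fun w => b i w ^+ 4) <= beta)
  (e4 : forall i j, finite_fourth P (e i j)) (e0 : forall i j, Exp P (e i j) = 0)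
  (e_var : forall i j, Exp P (fun w => e i j w ^+ 2) = v)
  (q0 : 0 <= q) (e_q : forall i j, Exp P (fun w => e i j w ^+ 4) <= q).

Let m2 i : (2 <= m i)%N. Proof. by have /andP[] := m2N i. Qed.
Let mR i : R := (m i)%:R.
Let mR2 i : 2 <= mR i. Proof. by rewrite ler_nat. Qed.
Let mRN i : mR i <= N%:R. Proof. by rewrite ler_nat; have /andP[] := m2N i. Qed.

Definition treatment (x : I) : 'I_k := match x with inl i => i | inr p => tag p end.

Definition error_indices (i : 'I_k) : seq I :=
  [seq (inr (Tagged (fun i => 'I_(m i)) j) : I) | j <- enum 'I_(m i)].

Definition error_sum (i : 'I_k) : T -> R := list_sum P X (error_indices i).
Definition error_pair (i : 'I_k) : T -> R := list_pair P X (error_indices i).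

Local Notation E := error_sum.
Local Notation G := error_pair.

Let error_indices_size i : size (error_indices i) = m i.
Proof. by rewrite size_map size_enum_ord. Qed.

Let error_indices_treatment i x : x \in error_indices i -> treatment x = i.
Proof. by move=> /mapP[j _ ->]. Qed.

Let error_moments i :
  [/\ finite_fourth P (E i), Exp P (E i) = 0,
      Exp P (fun w => E i w ^+ 2) = mR i * v &
      Exp P (fun w => E i w ^+ 4) <= sum_fourth q (m i)] /\
  [/\ finite_fourth P (G i), Exp P (G i) = 0,
      Exp P (fun w => G i w ^+ 2) = v ^+ 2 * (mR i * (mR i - 1) / 2) &
      Exp P (fun w => G i w ^+ 4) <= pair_fourth q (m i)].
Proof.
rewrite /mR -(error_indices_size i); apply: list_moments => //.
- rewrite map_inj_uniq ?enum_uniq// => j j' [/eqP].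
  by rewrite eq_Tagged => /eqP.
- by move=> _ /mapP[j _ ->]; split; [exact: e4|exact: e0|exact: e_var|exact: e_q].
Qed.

Lemma error_sumE i w : E i w = \sum_j e i j w.
Proof. by rewrite /E /list_sum big_map big_enum. Qed.

Lemma error_pairE i w : G i w = ((\sum_j e i j w) ^+ 2 - \sum_j e i j w ^+ 2) / 2.
Proof. by rewrite /G /list_pair -/(E i) error_sumE big_map big_enum. Qed.

Definition block (i : 'I_k) : {set I} := [set x | treatment x == i]%SET.

Let db i : determined_by P X (block i) (b i).
Proof. by apply: (determined_by_coord P X _ (inl i)); rewrite finset.inE. Qed.

Let block_error_indices i x : x \in error_indices i -> x \in block i.
Proof. by move=> /error_indices_treatment xi; rewrite finset.inE xi. Qed.

Let dE i : determined_by P X (block i) (E i).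
Proof. by apply: determined_by_list_sum; exact: block_error_indices.
Qed.

Let dG i : determined_by P X (block i) (G i).
Proof. by apply: determined_by_list_pair; exact: block_error_indices.
Qed.

Let bE i : independent2 P (b i) (E i).
Proof.
apply: (determined_by_independent P X indep [set inl i]%SET [set x in error_indices i]%SET).
- by rewrite disjoints1 finset.inE; apply/negP => /mapP[].
- by apply: (determined_by_coord P X _ (inl i)); rewrite finset.inE.
- by apply: determined_by_list_sum => x; rewrite finset.inE.
Qed.

Let centered (f : 'I_k -> T -> R) : (forall i, determined_by P X (block i) (f i)) ->
  (forall i, integrableR P (f i)) -> (forall i, integrableR P (fun w => f i w ^+ 2)) ->
  (forall i, Exp P (f i) = 0) -> centered_independent P f.
Proof. by move=> df f1 f2 f0; split => //; exact: (blocks_independent P X indep _ treatment). Qed.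

Let dZ (F : {set I}) (c : R) (f : T -> R) : determined_by P X F f ->
  determined_by P X F (fun w => c * f w).
Proof. by move=> df; apply: determined_byM => //; exact: determined_by_cst. Qed.

Let d2 (F : {set I}) (f : T -> R) : determined_by P X F f ->
  determined_by P X F (fun w => f w ^+ 2).
Proof. by move=> df; apply: (determined_by_comp _ _ _ (fun x => x ^+ 2)). Qed.

(** The variance of b_i^2 is its fourth moment minus tau^2, hence at most [beta]. *)
Lemma effects_sqr (alpha : 'I_k -> R) :
  let D w := \sum_i alpha i * (b i w ^+ 2 - tau) in
  integrableR P (fun w => D w ^+ 2) /\
  Exp P (fun w => D w ^+ 2) <= \sum_i alpha i ^+ 2 * beta.
Proof.
move=> D.
have i2 i := finite_fourth2 P _ (b4 i); have i4 i := (b4 i).2.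
have ic i : integrableR P (fun w => b i w ^+ 2 - tau).
  by apply: integrableRB => //; exact: integrableR_cst.
have sE i : (fun w => (alpha i * (b i w ^+ 2 - tau)) ^+ 2) =
    fun w => alpha i ^+ 2 * ((b i w ^+ 4 - (2 * tau) * b i w ^+ 2) + tau ^+ 2).
  by apply/funext => w; ring.
have is4 i : integrableR P (fun w => b i w ^+ 4 - (2 * tau) * b i w ^+ 2).
  by apply: integrableRB => //; exact: integrableRZ.
have is5 i : integrableR P (fun w => (b i w ^+ 4 - (2 * tau) * b i w ^+ 2) + tau ^+ 2).
  by apply: integrableRD => //; exact: integrableR_cst.
have /centered_independent_sqr[iD ED] :
    centered_independent P (fun i w => alpha i * (b i w ^+ 2 - tau)).
  apply: centered => i.
  - apply: dZ; apply: determined_byD; first exact: d2.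
    exact: determined_by_cst.
  - exact: integrableRZ.
  - by rewrite sE; exact: integrableRZ.
  - by rewrite ExpZ// ExpB//; [rewrite b_var Exp_cst subrr mulr0|exact: integrableR_cst].
split => //; rewrite ED; apply: ler_sum => i _; rewrite sE ExpZ// ler_wpM2l ?sqr_ge0//.
rewrite ExpD//; last exact: integrableR_cst.
rewrite ExpB//; last exact: integrableRZ.
by rewrite ExpZ// Exp_cst b_var; have := b_beta i; have := sqr_ge0 tau; lra.
Qed.

Lemma cross_sqr (alpha : 'I_k -> R) :
  let D w := \sum_i alpha i * (b i w * E i w) in
  integrableR P (fun w => D w ^+ 2) /\
  Exp P (fun w => D w ^+ 2) = \sum_i alpha i ^+ 2 * (tau * (mR i * v)).
Proof.
move=> D.
have E4 i : finite_fourth P (E i) by have [[]] := error_moments i.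
have bE4 i : finite_fourth P (fun w => b i w * E i w).
  by have [] := finite_fourthM P _ _ (b4 i) (E4 i) (bE i).
have a4 i := finite_fourthZ P (alpha i) _ (bE4 i).
have /centered_independent_sqr[iD ED] :
    centered_independent P (fun i w => alpha i * (b i w * E i w)).
  apply: centered => i.
  - by apply: dZ; exact: determined_byM.
  - exact: finite_fourth1.
  - exact: finite_fourth2.
  - rewrite ExpZ; last exact: finite_fourth1.
    rewrite independent2_ExpM ?b0 ?mul0r ?mulr0//; try exact: finite_fourth1.
    by case: (E4 i).
split => //; rewrite ED; apply: eq_bigr => i _.
have -> : (fun w => (alpha i * (b i w * E i w)) ^+ 2) =
    fun w => alpha i ^+ 2 * (b i w ^+ 2 * E i w ^+ 2) by apply/funext => w; ring.
have ind2 : independent2 P (fun w => b i w ^+ 2) (fun w => E i w ^+ 2).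
  exact: (independent2_comp P (fun x => x ^+ 2) (fun x => x ^+ 2)).
have mb2 := integrableR_measurable P (finite_fourth2 P _ (b4 i)).
have mE2 := integrableR_measurable P (finite_fourth2 P _ (E4 i)).
rewrite ExpZ; last by apply: independent2_integrableM => //; exact: finite_fourth2.
rewrite independent2_ExpM//; try exact: finite_fourth2.
by rewrite b_var; have [[_ _ -> _] _] := error_moments i.
Qed.

Lemma pairs_centered (alpha : 'I_k -> R) :
  centered_independent P (fun i w => alpha i * G i w).
Proof.
have a4 i : finite_fourth P (fun w => alpha i * G i w).
  by apply: finite_fourthZ; have [_ []] := error_moments i.
apply: centered => i; [exact: dZ|exact: finite_fourth1|exact: finite_fourth2|].
have [_ [G4 G0 _ _]] := error_moments i.
by rewrite ExpZ ?G0 ?mulr0//; exact: finite_fourth1.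
Qed.

Definition pair_fourth_bound : R := \sum_(i < N.+1) pair_fourth q i.

Lemma pairs_moments i :
  [/\ finite_fourth P (G i),
      Exp P (fun w => G i w ^+ 2) = v ^+ 2 * (mR i * (mR i - 1) / 2) &
      Exp P (fun w => G i w ^+ 4) <= pair_fourth_bound].
Proof.
have [_ [G4 G0 GV Gq]] := error_moments i; split => //.
rewrite (le_trans Gq)//; apply: ler_prefix_sum; last by have /andP[] := m2N i.
by move=> j; exact: pair_fourth_ge0.
Qed.

(** 3 comes from squaring a sum of three terms; 17 = 16 + 1, where 16 bounds the square of 2 m_i /
    (m_i - 1) <= 4 and 1 belongs to the constant m_i v. *)
Definition within_bound : R :=
  3 * (\sum_(i < N.+1) sum_fourth q i + 17 * v ^+ 2 * N%:R ^+ 2).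

(** This is m_i (U_i - v), rewritten with sum_j e_ij^2 = E_i^2 - 2 G_i so that its moments come from
    those of E_i and G_i. *)
Definition within_error i w : R := E i w ^+ 2 - 2 * mR i / (mR i - 1) * G i w - mR i * v.

Lemma within_sqr :
  let D w := \sum_i within_error i w in
  integrableR P (fun w => D w ^+ 2) /\
  Exp P (fun w => D w ^+ 2) <= k%:R * within_bound.
Proof.
move=> D.
have E4 i : finite_fourth P (E i) by have [[]] := error_moments i.
have G4 i : finite_fourth P (G i) by have [_ []] := error_moments i.
have iE2 i := finite_fourth2 P _ (E4 i); have iG1 i := finite_fourth1 P _ (G4 i).
have iG2 i := finite_fourth2 P _ (G4 i).
have iW i : integrableR P (within_error i).
  apply: integrableRB; last exact: integrableR_cst.
  by apply: integrableRB => //; exact: integrableRZ.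
have mW i := integrableR_measurable P (iW i).
have iB i : integrableR P (fun w => 3 * (E i w ^+ 4 + 16 * G i w ^+ 2 + (mR i * v) ^+ 2)).
  apply: integrableRZ; apply: integrableRD; last exact: integrableR_cst.
  by apply: integrableRD; [exact: (E4 i).2|exact: integrableRZ].
have leB i w : within_error i w ^+ 2 <=
    3 * (E i w ^+ 4 + 16 * G i w ^+ 2 + (mR i * v) ^+ 2).
  rewrite /within_error; have r4 : 0 <= 2 * mR i / (mR i - 1) <= 4.
    have := mR2 i => mi; apply/andP; split; first by rewrite divr_ge0//; lra.
    by rewrite ler_pdivrMr; lra.
  move: r4 (E i w) (G i w) (mR i * v); set r := _ / _ => /andP[r0 r4] x y z.
  have : r ^+ 2 * y ^+ 2 <= 16 * y ^+ 2 by rewrite ler_wpM2r ?sqr_ge0//; nra.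
  have := sqr_ge0 (x ^+ 2 + r * y); have := sqr_ge0 (x ^+ 2 + z); have := sqr_ge0 (r * y - z).
  have -> : x ^+ 4 = (x ^+ 2) ^+ 2 by rewrite -exprM.
  by move: (x ^+ 2) => u; nra.
have iW2 i : integrableR P (fun w => within_error i w ^+ 2).
  apply: integrableR_le (iB i) => [|w]; first exact: measurable_funX.
  by rewrite ger0_norm ?sqr_ge0.
have /centered_independent_sqr[iD ED] : centered_independent P within_error.
  apply: centered => // i.
    rewrite /within_error; apply: determined_byD; last exact: determined_by_cst.
    apply: determined_byD; first exact: d2.
    by apply: (determined_by_comp _ _ _ -%R) => //; exact: dZ.
  rewrite /within_error ExpB; [|by apply: integrableRB => //; exact: integrableRZ|exact: integrableR_cst].
  rewrite ExpB//; last exact: integrableRZ.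
  by rewrite ExpZ// Exp_cst; have [[_ _ -> _] [_ -> _ _]] := error_moments i; ring.
split => //; rewrite ED.
have -> : k%:R * within_bound = \sum_(i < k) within_bound.
  by rewrite sumr_const card_ord mulr_natl.
apply: ler_sum => i _; apply: (le_trans (le_Exp P _ _ (iW2 i) (iB i) (leB i))).
have iE4 := (E4 i).2.
rewrite ExpZ; last first.
  apply: integrableRD; last exact: integrableR_cst.
  by apply: integrableRD => //; exact: integrableRZ.
rewrite ExpD; [|by apply: integrableRD => //; exact: integrableRZ|exact: integrableR_cst].
rewrite ExpD//; last exact: integrableRZ.
rewrite ExpZ// Exp_cst ler_wpM2l//.
have [[_ _ _ Eq] [_ _ -> _]] := error_moments i.
have : sum_fourth q (m i) <= \sum_(i < N.+1) sum_fourth q i.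
  apply: ler_prefix_sum; last by have /andP[] := m2N i.
  by move=> j; exact: sum_fourth_ge0.
have mN2 : mR i ^+ 2 <= N%:R ^+ 2 by rewrite lerXn2r ?nnegrE.
have : v ^+ 2 * mR i ^+ 2 <= v ^+ 2 * N%:R ^+ 2 by rewrite ler_wpM2l ?sqr_ge0.
have : 0 <= v ^+ 2 * mR i by rewrite mulr_ge0 ?sqr_ge0.
move: (N%:R ^+ 2) (mR i) => u t *; rewrite exprMn.
by nra.
Qed.

Definition block_total i w : R := mR i * b i w + E i w.

(** No variance is computed: the triangle inequality suffices, since the square of the sum and the
    sum of the squares have the same expectation, of order n. *)
Lemma between_abs :
  let D w := ((\sum_i block_total i w) ^+ 2 - \sum_i block_total i w ^+ 2) / 2 in
  integrableR P D /\
  Exp P (fun w => `|D w|) <= \sum_i (mR i ^+ 2 * tau + mR i * v).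
Proof.
move=> D.
have E4 i : finite_fourth P (E i) by have [[]] := error_moments i.
have ib1 i := finite_fourth1 P _ (b4 i); have iE1 i := finite_fourth1 P _ (E4 i).
have ib2 i := finite_fourth2 P _ (b4 i); have iE2 i := finite_fourth2 P _ (E4 i).
have t4 i : finite_fourth P (block_total i).
  by have [] := finite_fourthD P _ _ (finite_fourthZ P (mR i) _ (b4 i)) (E4 i).
have ibE i : integrableR P (fun w => b i w * E i w) by exact: finite_fourth_integrableM.
have it2 i := finite_fourth2 P _ (t4 i).
have tV i : Exp P (fun w => block_total i w ^+ 2) = mR i ^+ 2 * tau + mR i * v.
  have -> : (fun w => block_total i w ^+ 2) = fun w =>
      (mR i ^+ 2 * b i w ^+ 2 + E i w ^+ 2) + (2 * mR i) * (b i w * E i w).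
    by apply/funext => w; rewrite /block_total; ring.
  rewrite ExpD; [|by apply: integrableRD => //; exact: integrableRZ|exact: integrableRZ].
  rewrite ExpD//; last exact: integrableRZ.
  rewrite !ExpZ// b_var independent2_ExpM ?b0 ?mul0r//; try by [case: (b4 i)|case: (E4 i)].
  by have [[_ _ -> _] _] := error_moments i; ring.
have /centered_independent_sqr[iS ES] : centered_independent P block_total.
  apply: centered => // i.
  - by apply: determined_byD => //; exact: dZ.
  - exact: finite_fourth1.
  - rewrite ExpD//; last exact: integrableRZ.
    by rewrite ExpZ// b0; have [[_ -> _ _] _] := error_moments i; ring.
have iQ : integrableR P (fun w => \sum_i block_total i w ^+ 2) by exact: integrableR_sum.
have iD : integrableR P D.
  have -> : D = fun w => 2^-1 * ((\sum_i block_total i w) ^+ 2 - \sum_i block_total i w ^+ 2).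
    by apply/funext => w; rewrite /D mulrC.
  by apply: integrableRZ; exact: integrableRB.
split => //.
have iB : integrableR P (fun w => 2^-1 * ((\sum_i block_total i w) ^+ 2 + \sum_i block_total i w ^+ 2)).
  by apply: integrableRZ; exact: integrableRD.
apply: (le_trans (le_Exp P _ _ (integrableR_norm P iD) iB _)).
  move=> w; rewrite /D normrM [X in _ * X]ger0_norm ?invr_ge0// mulrC ler_wpM2l ?invr_ge0//.
  rewrite (le_trans (ler_normB _ _))// !ger0_norm ?sqr_ge0//.
  by apply: sumr_ge0 => i _; exact: sqr_ge0.
rewrite ExpZ; last exact: integrableRD.
rewrite ExpD// ES Exp_sum//.
under eq_bigr do rewrite tV.
by lra.
Qed.

Let a i : R := (n%:R - mR i) / (mR i - 1).

Lemma numeratorE w : ('C(n, 2))%:R * @Bstat R k m (fun i j => Yobs mu b e j w) =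
  \sum_i a i * (mR i * (mR i - 1) / 2 * b i w ^+ 2) +
  \sum_i a i * (mR i - 1) * (b i w * E i w) + \sum_i a i * G i w -
  ((\sum_i block_total i w) ^+ 2 - \sum_i block_total i w ^+ 2) / 2.
Proof.
have tE i : \sum_j (b i w + e i j w) = block_total i w.
  by rewrite big_split/= sumr_const card_ord -error_sumE -mulr_natl.
rewrite (BstatE k m m2 _ (fun i j => b i w + e i j w) (fun=> mu))//; last first.
  by move=> i j; rewrite /Yobs addrA.
congr (_ - _); last first.
  by congr (_ / 2); congr (_ ^+ 2 - _); apply: eq_bigr => i _; rewrite tE.
rewrite -!big_split/=; apply: eq_bigr => i _.
transitivity (a i * (mR i * (mR i - 1) / 2 * b i w ^+ 2 +
  (mR i - 1) * (b i w * E i w) + G i w)); last by ring.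
congr (_ * _); rewrite tE /block_total error_pairE -error_sumE.
have -> : \sum_j (b i w + e i j w) ^+ 2 =
    mR i * b i w ^+ 2 + 2 * b i w * E i w + \sum_j e i j w ^+ 2.
  transitivity (\sum_j (b i w ^+ 2 + 2 * b i w * e i j w + e i j w ^+ 2)).
    by apply: eq_bigr => j _; ring.
  by rewrite !big_split/= sumr_const card_ord -[_ *+ m i]mulr_natl -mulr_sumr -error_sumE.
by field.
Qed.

(** The effects cancel within treatments, so the deviation of W from v involves the errors only;
    [0 < k] excludes the empty sample. *)
Lemma denominatorE w : (0 < k)%N -> @Wstat R k m (fun i j => Yobs mu b e j w) =
  v + (\sum_i within_error i w) / n%:R.
Proof.
move=> k0; rewrite (WstatE k m m2 _ (fun i j => e i j w) (fun i => mu + b i w))//.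
have n0 : n%:R != 0 :> R.
  by rewrite pnatr_eq0 /nobs (bigD1 (Ordinal k0))//= -lt0n addn_gt0 (ltn_trans _ (m2 _)).
have -> : v = (\sum_i mR i * v) / n%:R.
  by rewrite -mulr_suml -natr_sum -/n mulrC mulKf.
rewrite -mulrDl -mulr_suml -big_split/=; congr (_ / _); apply: eq_bigr => i _.
rewrite /within_error error_pairE -error_sumE -/(mR i).
have m1 : mR i - 1 != 0 by rewrite gt_eqF//; have := mR2 i; lra.
by field.
Qed.

End blocks.

(** * Convergence in probability *)

Lemma near_le_cvg0 {R : realType} (u v : nat -> R) :
  (\forall k \near \oo, `|u k| <= v k) -> v @ \oo --> (0 : R) -> u @ \oo --> (0 : R).
Proof.
move=> uv v0; apply/cvgrPdist_le => eps e0; near=> k.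
rewrite sub0r normrN; apply: (@le_trans _ _ (v k)); first by near: k.
by near: k; apply: cvgr_le v0 _ _.
Unshelve. all: by end_near. Qed.

Section small_in_probability.
Context {R : realType} {d : nat -> measure_display}
  {T : forall k, measurableType (d k)} (P : forall k, probability (T k) R).

Definition small_in_probability (X : forall k, T k -> R) : Prop :=
  forall eta eps : R, 0 < eta -> 0 < eps ->
    \forall k \near \oo, Pr (P k) [set w | eta <= `|X k w|] <= eps.

Lemma small_L1 (X : forall k, T k -> R) (u : nat -> R) :
  (\forall k \near \oo, integrableR (P k) (X k) /\ Exp (P k) (fun w => `|X k w|) <= u k) ->
  u @ \oo --> (0 : R) -> small_in_probability X.
Proof.
move=> Xu u0 eta eps eta0 eps0; near=> k.
have [iX EX] : integrableR (P k) (X k) /\ Exp (P k) (fun w => `|X k w|) <= u k by near: k.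
rewrite (le_trans (Pr_markov _ _ _ eta0 (integrableR_norm _ iX) _))//.
rewrite ler_pdivrMr// (le_trans EX)//.
by near: k; apply: cvgr_le u0 _ _; rewrite mulr_gt0.
Unshelve. all: by end_near. Qed.

Lemma small_L2 (X : forall k, T k -> R) (u : nat -> R) :
  (\forall k \near \oo, integrableR (P k) (fun w => X k w ^+ 2) /\
                        Exp (P k) (fun w => X k w ^+ 2) <= u k) ->
  u @ \oo --> (0 : R) -> small_in_probability X.
Proof.
move=> Xu u0 eta eps eta0 eps0; near=> k.
have [iX EX] : integrableR (P k) (fun w => X k w ^+ 2) /\
  Exp (P k) (fun w => X k w ^+ 2) <= u k by near: k.
have -> : [set w | eta <= `|X k w|] = [set w | eta ^+ 2 <= X k w ^+ 2].
  apply/funext => w /=; rewrite -[X k w ^+ 2]ger0_norm ?sqr_ge0// normrX.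
  by rewrite ler_sqr ?nnegrE// ltW.
have eta2 : 0 < eta ^+ 2 by rewrite exprn_gt0.
rewrite (le_trans (Pr_markov _ _ _ eta2 iX _))//; first by move=> w; exact: sqr_ge0.
rewrite ler_pdivrMr ?exprn_gt0// (le_trans EX)//.
by near: k; apply: cvgr_le u0 _ _; rewrite mulr_gt0// exprn_gt0.
Unshelve. all: by end_near. Qed.

Lemma small_cst (u : nat -> R) : u @ \oo --> (0 : R) ->
  small_in_probability (fun k _ => u k).
Proof.
move=> u0 eta eps eta0 eps0; near=> k.
have uk : `|u k| < eta.
  near: k; move/cvgrPdist_lt : u0 => /(_ eta eta0).
  by apply: filterS => k; rewrite sub0r normrN.
have -> : [set w : T k | eta <= `|u k|] = set0.
  by apply/seteqP; split => w //=; rewrite leNgt uk.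
by rewrite /Pr measure0 ltW.
Unshelve. all: by end_near. Qed.

Lemma small_add (X Y : forall k, T k -> R) :
  (forall k, measurable_fun setT (X k)) -> (forall k, measurable_fun setT (Y k)) ->
  small_in_probability X -> small_in_probability Y ->
  small_in_probability (fun k w => X k w + Y k w).
Proof.
move=> mX mY sX sY eta eps eta0 eps0.
have h0 : 0 < eta / 2 by rewrite divr_gt0.
have e0 : 0 < eps / 2 by rewrite divr_gt0.
near=> k.
have m2 (Z : T k -> R) c : measurable_fun setT Z -> measurable [set w | c <= `|Z w|].
  by move=> mZ; apply: measurable_ge_cst; exact: measurableT_comp.
apply: (@le_trans _ _ (Pr (P k) ([set w | eta / 2 <= `|X k w|] `|` [set w | eta / 2 <= `|Y k w|]))).
  apply: le_Pr; [apply: m2; exact: measurable_funD|by apply: measurableU; exact: m2|].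
  move=> w /= H; have [?|Xw] := leP (eta / 2) `|X k w|; [by left|right].
  by have := ler_normD (X k w) (Y k w); lra.
apply: (le_trans (Pr_setU _ _ _ _ _)); [exact: m2|exact: m2|].
have -> : eps = eps / 2 + eps / 2 by field.
apply: lerD.
  by near: k; exact: sX.
by near: k; exact: sY.
Unshelve. all: by end_near. Qed.

(** A Slutsky argument on distribution functions: off an event of small probability, [D] moves the
    threshold by at most eta and the comparison of [J] with [x] may be replaced by that of
    [Z + D]. *)
Lemma cvg_cdf_transfer (Q : probability (measurableTypeR R) R)
    (J Z D H : forall k, T k -> R) (x h : R) :
  (forall k, measurable_fun setT (J k)) -> (forall k, measurable_fun setT (Z k)) ->
  (forall k, measurable_fun setT (D k)) -> (forall k, measurable_fun setT (H k)) ->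
  small_in_probability D -> small_in_probability H -> 0 < h ->
  (\forall k \near \oo, forall w, `|H k w| < h -> (J k w <= x) = (Z k w + D k w <= x)) ->
  (forall a a' eps : R, a < a' -> 0 < eps -> \forall k \near \oo,
    Pr (P k) [set w | Z k w <= a] <= Pr Q `]-oo, a']%classic + eps /\
    Pr Q `]-oo, a]%classic <= Pr (P k) [set w | Z k w <= a'] + eps) ->
  {for x, continuous (fun t : R => Q `]-oo, t]%classic)} ->
  (fun k => P k [set w | J k w <= x]) @ \oo --> Q `]-oo, x]%classic.
Proof.
move=> mJ mZ mD mH sD sH h0 JZ clt cQ.
pose F (t : R) : R := Pr Q `]-oo, t]%classic.
have QE t : Q `]-oo, t]%classic = (F t)%:E by rewrite /F PrE//; exact: measurable_itv.
have cF : {for x, continuous F}.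
  have := cQ; rewrite /prop_for /continuous_at QE.
  by move=> /fine_cvgP[_].
rewrite QE.
have mJx k : measurable [set w | J k w <= x] by exact: measurable_le_cst.
suff : (fun k => Pr (P k) [set w | J k w <= x]) @ \oo --> F x.
  move=> cv; have -> : (fun k => P k [set w | J k w <= x]) =
     EFin \o (fun k => Pr (P k) [set w | J k w <= x]).
    by apply/funext => k /=; rewrite -PrE.
  by apply: cvg_EFin => //; near=> k.
apply/cvgrPdist_le => eps e0.
have e4 : 0 < eps / 4 by rewrite divr_gt0.
(* Twice eta: one shift absorbs [D], the other is the gap between [a] and [a'] in the limit theorem
   for [Z]. The four quarters of [eps] go to [D], [H], that theorem and the continuity at [x]. *)
have [eta eta0 etaF] : exists2 eta : R, 0 < eta & forall t, `|t - x| <= 2 * eta -> `|F x - F t| <= eps / 4.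
  move/cvgrPdist_le : cF => /(_ _ e4) /nbhs_ballP[r /= r0 rF].
  exists (r / 4); first by rewrite divr_gt0.
  move=> t tx; apply: rF; rewrite /ball/= distrC; move: tx => /le_lt_trans; apply.
  have -> : 2 * (r / 4) = r / 2 by field.
  by rewrite ltr_pdivrMr// ltr_pMr// ltr1n.
have F1 := etaF (x + 2 * eta); have F2 := etaF (x - 2 * eta).
have {}F1 : `|F x - F (x + 2 * eta)| <= eps / 4.
  by apply: F1; rewrite addrAC subrr add0r ger0_norm// mulr_ge0// ltW.
have {}F2 : `|F x - F (x - 2 * eta)| <= eps / 4.
  by apply: F2; rewrite addrAC subrr add0r normrN ger0_norm// mulr_ge0// ltW.
near=> k.
have hD : Pr (P k) [set w | eta <= `|D k w|] <= eps / 4 by near: k; exact: sD.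
have hH : Pr (P k) [set w | h <= `|H k w|] <= eps / 4 by near: k; exact: sH.
have hJ w : `|H k w| < h -> (J k w <= x) = (Z k w + D k w <= x).
  by move: w; near: k.
have [U _] : Pr (P k) [set w | Z k w <= x + eta] <= F (x + 2 * eta) + eps / 4 /\
    F (x + eta) <= Pr (P k) [set w | Z k w <= x + 2 * eta] + eps / 4.
  by near: k; apply: clt => //; lra.
have [_ L] : Pr (P k) [set w | Z k w <= x - 2 * eta] <= F (x - eta) + eps / 4 /\
    F (x - 2 * eta) <= Pr (P k) [set w | Z k w <= x - eta] + eps / 4.
  by near: k; apply: clt => //; lra.
pose bad := [set w | eta <= `|D k w|] `|` [set w | h <= `|H k w|].
have mD' : measurable [set w | eta <= `|D k w|].
  by apply: measurable_ge_cst; exact: measurableT_comp.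
have mH' : measurable [set w | h <= `|H k w|].
  by apply: measurable_ge_cst; exact: measurableT_comp.
have mbad : measurable bad by exact: measurableU.
have Pbad : Pr (P k) bad <= eps / 2.
  rewrite (le_trans (Pr_setU _ _ _ mD' mH'))// (_ : eps / 2 = eps / 4 + eps / 4) ?lerD//.
  by field.
have mZx t : measurable [set w | Z k w <= t] by exact: measurable_le_cst.
have S1 : [set w | J k w <= x] `<=` [set w | Z k w <= x + eta] `|` bad.
  move=> w /= Jw; have [?|Dw] := leP eta `|D k w|; first by right; left.
  have [?|Hw] := leP h `|H k w|; first by right; right.
  by left; move: Jw; rewrite hJ//; move: Dw; rewrite ltr_norml => /andP[]; lra.
have S2 : [set w | Z k w <= x - eta] `<=` [set w | J k w <= x] `|` bad.
  move=> w /= Zw; have [?|Dw] := leP eta `|D k w|; first by right; left.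
  have [?|Hw] := leP h `|H k w|; first by right; right.
  by left; rewrite hJ//; move: Dw; rewrite ltr_norml => /andP[]; lra.
have B1 := le_trans (le_Pr (P k) _ _ (mJx k) (measurableU _ _ (mZx _) mbad) S1)
  (Pr_setU _ _ _ (mZx _) mbad).
have B2 := le_trans (le_Pr (P k) _ _ (mZx _) (measurableU _ _ (mJx k) mbad) S2)
  (Pr_setU _ _ _ (mJx k) mbad).
have := F1; have := F2; rewrite !ler_norml => /andP[_ G2] /andP[G1 _].
by apply/andP; split; lra.
Unshelve. all: by end_near. Qed.

End small_in_probability.

(** * Asymptotics of the design *)

Section design_asymptotics.
Context {R : realType} (m : forall k : nat, 'I_k -> nat) (N : nat) (lambda : R).
Arguments m : clear implicits.
Hypothesis mN : forall k (i : 'I_k), (2 <= m k i <= N)%N.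

Definition obs k : R := (nobs (m k))%:R.
Definition weight k (i : 'I_k) : R := (obs k - (m k i)%:R) / ((m k i)%:R - 1).
Definition root_M k : R := Num.sqrt (Mstat R (m k)).
(** The constant in kappa n^3 <= M. For n >= 2 N each treatment contributes a_i^2 C(m_i, 2) >= (n -
    m_i)^2 / 2 >= n^2 / 8, and there are at least n / N treatments. Consequently [rate] bounds n /
    sqrt M. *)
Definition kappa : R := (8 * N%:R)^-1.
Definition rate k : R := Num.sqrt (kappa * obs k)^-1.

Local Notation mR k i := ((m k i)%:R : R).

Lemma mR_ge2 k i : 2 <= mR k i.
Proof. by rewrite ler_nat; have /andP[] := mN k i. Qed.

Lemma mR_leN k i : mR k i <= N%:R.
Proof. by rewrite ler_nat; have /andP[] := mN k i. Qed.

(** The size bounds hold for every number of treatments, so the design with a single one gives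
    it. *)
Lemma N_ge2 : 2 <= N%:R :> R.
Proof. exact: le_trans (mR_ge2 1 ord0) (mR_leN 1 ord0). Qed.

Lemma kappa_gt0 : 0 < kappa.
Proof. by rewrite invr_gt0; have := N_ge2; lra. Qed.

Lemma obs_sum k : obs k = \sum_i mR k i.
Proof. by rewrite /obs /nobs natr_sum. Qed.

Lemma obs_ge0 k : 0 <= obs k. Proof. by []. Qed.

Lemma le_mR_obs k i : mR k i <= obs k.
Proof. by rewrite ler_nat /nobs (bigD1 i)//= leq_addr. Qed.

Lemma k_le_obs k : k%:R <= obs k.
Proof.
have -> : k%:R = \sum_(i < k) (1 : R) by rewrite sumr_const card_ord.
by rewrite obs_sum; apply: ler_sum => i _; have := mR_ge2 k i; lra.
Qed.

Lemma obs_le k : obs k <= N%:R * k%:R.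
Proof.
have -> : N%:R * k%:R = \sum_(i < k) (N%:R : R) by rewrite sumr_const card_ord mulr_natr.
by rewrite obs_sum; apply: ler_sum => i _; exact: mR_leN.
Qed.

Lemma sum_sqr_size_le k : 0 <= \sum_i mR k i ^+ 2 <= N%:R * obs k.
Proof.
apply/andP; split; first by apply: sumr_ge0 => i _; exact: sqr_ge0.
rewrite obs_sum mulr_sumr; apply: ler_sum => i _.
by rewrite expr2 ler_wpM2r// mR_leN.
Qed.

Lemma sum_sqr_size_le2 k : \sum_i mR k i ^+ 2 <= obs k ^+ 2.
Proof.
rewrite [in leRHS]expr2 [X in _ <= X * _]obs_sum mulr_suml; apply: ler_sum => i _.
by rewrite expr2 ler_wpM2l// le_mR_obs.
Qed.

Lemma weight_ge0 k i : 0 <= weight k i.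
Proof.
rewrite divr_ge0 ?subr_ge0 ?le_mR_obs//.
by have := mR_ge2 k i; lra.
Qed.

Lemma weightM k i : weight k i * (mR k i - 1) = obs k - mR k i.
Proof. by rewrite /weight mulfVK// gt_eqF//; have := mR_ge2 k i; lra. Qed.

Lemma weight_le k i : weight k i <= obs k.
Proof.
have mi := mR_ge2 k i; rewrite ler_pdivrMr; last by lra.
have := obs_ge0 k; have := le_mR_obs k i; nra.
Qed.

Lemma near_obs_ge (C : R) : \forall k \near \oo, C <= obs k.
Proof.
near=> k; rewrite (le_trans _ (k_le_obs k))//.
by near: k; exact: nbhs_infty_ger.
Unshelve. all: by end_near. Qed.

Lemma inv_obs_cvg0 : (fun k => (obs k)^-1) @ \oo --> (0 : R).
Proof.
apply/cvgrPdist_le => eps e0; near=> k.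
have : eps^-1 <= obs k by near: k; exact: near_obs_ge.
move=> H; rewrite sub0r normrN ger0_norm ?invr_ge0 ?obs_ge0//.
rewrite -[leRHS]invrK lef_pV2// posrE ?invr_gt0//.
by apply: lt_le_trans H; rewrite invr_gt0.
Unshelve. all: by end_near. Qed.

Lemma sqrt_inv_cvg0 (c : R) : (fun k => Num.sqrt (c * (obs k)^-1)) @ \oo --> (0 : R).
Proof.
have := continuous_cvg _ (@sqrt_continuous R (c * 0)) (cvgM (cvg_cst (c : R)) inv_obs_cvg0).
by rewrite mulr0 sqrtr0; exact.
Qed.

Lemma rate_cvg0 : rate @ \oo --> (0 : R).
Proof.
have -> : rate = fun k => Num.sqrt (kappa^-1 * (obs k)^-1).
  by apply/funext => k; rewrite /rate invfM.
exact: sqrt_inv_cvg0.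
Qed.

Lemma rate_sqr k : 0 < obs k -> obs k * rate k ^+ 2 = kappa^-1.
Proof.
move=> n0; have k0 := kappa_gt0.
rewrite sqr_sqrtr ?invr_ge0 ?mulr_ge0 ?obs_ge0 ?(ltW k0)// invfM mulrCA divff ?mulr1//.
by rewrite gt_eqF.
Qed.

Lemma MstatE_weight k : Mstat R (m k) =
  \sum_i weight k i ^+ 2 * (mR k i * (mR k i - 1) / 2) +
  (obs k ^+ 2 - \sum_i mR k i ^+ 2) / 2.
Proof. by rewrite MstatE// => i; have /andP[] := mN k i. Qed.

Lemma near_M_ge : \forall k \near \oo, kappa * obs k ^+ 3 <= Mstat R (m k).
Proof.
near=> k.
have nN : 2 * N%:R <= obs k by near: k; exact: near_obs_ge.
have N2 := N_ge2.
rewrite MstatE_weight.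
have H1 : \sum_(i < k) obs k ^+ 2 / 8 <=
    \sum_i weight k i ^+ 2 * (mR k i * (mR k i - 1) / 2).
  apply: ler_sum => i _; have mi := mR_ge2 k i; have miN := mR_leN k i.
  have wE := weightM k i; have w0 := weight_ge0 k i.
  have : obs k / 2 <= weight k i * (mR k i - 1) by rewrite wE; lra.
  move=> H; have H2 : (obs k / 2) ^+ 2 <= (weight k i * (mR k i - 1)) ^+ 2.
    by rewrite lerXn2r ?nnegrE//; [lra|apply: mulr_ge0 => //; lra].
  have : weight k i ^+ 2 * (mR k i - 1) ^+ 2 <= weight k i ^+ 2 * (mR k i * (mR k i - 1)).
    by rewrite ler_wpM2l ?sqr_ge0//; nra.
  by move: H2; rewrite !exprMn; lra.
have := sum_sqr_size_le2 k; move: H1; rewrite sumr_const card_ord -mulr_natl => H1 H2.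
have H3 : kappa * obs k ^+ 3 <= k%:R * (obs k ^+ 2 / 8).
  have -> : kappa * obs k ^+ 3 = obs k / N%:R * (obs k ^+ 2 / 8).
    by rewrite /kappa; field; rewrite gt_eqF//; lra.
  rewrite ler_wpM2r//; first by rewrite divr_ge0 ?sqr_ge0.
  by rewrite ler_pdivrMr; [rewrite mulrC obs_le|lra].
by lra.
Unshelve. all: by end_near. Qed.

Lemma near_root_M : \forall k \near \oo,
  [/\ 0 < root_M k, root_M k ^+ 2 = Mstat R (m k), 0 < obs k & obs k / root_M k <= rate k].
Proof.
near=> k.
have n1 : 1 <= obs k by near: k; exact: near_obs_ge.
have MK : kappa * obs k ^+ 3 <= Mstat R (m k) by near: k; exact: near_M_ge.
have k0 := kappa_gt0; have n0 : 0 < obs k by lra.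
have kn0 : 0 < kappa * obs k ^+ 3 by rewrite mulr_gt0// exprn_gt0.
have M0 : 0 < Mstat R (m k) by exact: lt_le_trans MK.
have s0 : 0 < root_M k by rewrite sqrtr_gt0.
have sE : root_M k ^+ 2 = Mstat R (m k) by rewrite sqr_sqrtr// ltW.
split => //.
rewrite -[leLHS]ger0_norm ?divr_ge0 ?obs_ge0 ?(ltW s0)// -sqrtr_sqr.
rewrite ler_wsqrtr// exprMn exprVn sE ler_pdivrMr//.
have -> : obs k ^+ 2 = (kappa * obs k)^-1 * (kappa * obs k ^+ 3).
  by field; rewrite !gt_eqF.
by rewrite ler_wpM2l// invr_ge0 mulr_ge0// ltW.
Unshelve. all: by end_near. Qed.

Hypothesis M_cvg : (fun k => Mstat R (m k) / (nobs (m k))%:R ^+ 3) @ \oo --> lambda.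

(** The lower bound on M passes to the limit, which makes the division by sqrt lambda in the limit
    mean genuine. *)
Lemma lambda_gt0 : 0 < lambda.
Proof.
apply: (lt_le_trans kappa_gt0).
rewrite -(cvg_lim (@Rhausdorff R) M_cvg); apply: limr_ge; first by apply/cvg_ex; exists lambda.
near=> k.
have n1 : 1 <= obs k by near: k; exact: near_obs_ge.
have n0 : 0 < obs k by lra.
by rewrite -/(obs k) ler_pdivlMr ?exprn_gt0//; near: k; exact: near_M_ge.
Unshelve. all: by end_near. Qed.

(** The quotient is sqrt (n^3 / M), written as it arises from tau (of order 1 / sqrt n) times n^2,
    over sqrt M. *)
Lemma obs_root_M_cvg :
  (fun k => obs k ^+ 2 / (Num.sqrt (obs k) * root_M k)) @ \oo --> (Num.sqrt lambda)^-1.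
Proof.
have l0 := lambda_gt0.
have sl0 : Num.sqrt lambda != 0 by rewrite gt_eqF// sqrtr_gt0.
have c1 : (fun k => (Num.sqrt (Mstat R (m k) / (nobs (m k))%:R ^+ 3))^-1) @ \oo -->
    (Num.sqrt lambda)^-1.
  by apply: cvgV => //; exact: (continuous_cvg _ (@sqrt_continuous R lambda) M_cvg).
apply: cvg_trans c1; apply: near_eq_cvg; near=> k.
have [s0 sE n0 _] : [/\ 0 < root_M k, root_M k ^+ 2 = Mstat R (m k), 0 < obs k &
  obs k / root_M k <= rate k] by near: k; exact: near_root_M.
rewrite -/(obs k) /=.
have r0 : 0 < Num.sqrt (obs k) by rewrite sqrtr_gt0.
have rE : Num.sqrt (obs k) ^+ 2 = obs k by rewrite sqr_sqrtr// ltW.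
have -> : Mstat R (m k) / obs k ^+ 3 = (root_M k / (Num.sqrt (obs k) * obs k)) ^+ 2.
  by rewrite expr_div_n exprMn rE sE -exprS.
rewrite sqrtr_sqr ger0_norm; last by rewrite divr_ge0 ?mulr_ge0 ?ltW.
rewrite invf_div [obs k ^+ 2](_ : _ = obs k * Num.sqrt (obs k) ^+ 2); last by rewrite rE expr2.
by field; rewrite !gt_eqF.
Unshelve. all: by end_near. Qed.

End design_asymptotics.

(** * Local alternatives *)

Lemma variance_Exp {R : realType} {d} {T : measurableType d} (P : probability T R)
    (X : T -> R) : ('E_P[X] = 0)%E -> integrableR P (fun w => X w ^+ 2) ->
  ('V_P[X] = (Exp P (fun w => X w ^+ 2))%:E)%E.
Proof.
move=> X0 X2; rewrite /variance unlock X0 -Exp_expectation//; congr expectation.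
by apply/funext => w; transitivity ((X w - 0) * (X w - 0)) => //; rewrite subr0 expr2.
Qed.

(** Nonnegativity of [f] allows the change of variables without integrability. *)
Lemma same_distribution_Exp {R : realType} {d d'} {T : measurableType d}
    {T' : measurableType d'} {P : probability T R} {P' : probability T' R}
    (X : {RV P >-> R}) (X' : {RV P' >-> R}) (f : R -> R) :
  measurable_fun setT f -> (forall x, 0 <= f x) ->
  same_distribution P P' X X' -> Exp P (fun w => f (X w)) = Exp P' (fun w => f (X' w)).
Proof.
move=> mf f0 XX'; rewrite /Exp /Rintegral; congr fine.
have mE : measurable_fun setT (EFin \o f) by exact/measurable_EFinP.
have E0 y : (0 <= (EFin \o f) y)%E by rewrite lee_fin.
rewrite -[LHS](ge0_integral_distribution X mE E0).
rewrite -[RHS](ge0_integral_distribution X' mE E0).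
by apply: eq_measure_integral => A mA _; exact: XX'.
Qed.

Section local_alternatives.
Context {R : realType} (m : forall k : nat, 'I_k -> nat) (d : nat -> measure_display)
  (T : forall k, measurableType (d k)) (P : forall k, probability (T k) R) (mu : R)
  (b : forall k, 'I_k -> {RV (P k) >-> R})
  (e : forall k (i : 'I_k), 'I_(m k i) -> {RV (P k) >-> R})
  (delta lambda v q : R) (N : nat).
Arguments m : clear implicits.
Arguments b : clear implicits.
Arguments e : clear implicits.
Local Notation n := (@obs R m).
Local Notation s := (@root_M R m).
Local Notation mR k i := ((m k i)%:R : R).

Definition effect_variance k : R := delta ^+ 2 / Num.sqrt (n k).
Local Notation tau := effect_variance.

Hypotheses (mN : forall k (i : 'I_k), (2 <= m k i <= N)%N)
  (indep : forall k, mutually_independent (P k) (effects_and_errors (b k) (e k)))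
  (b4 : forall k i, finite_fourth (P k) (b k i)) (b0 : forall k i, Exp (P k) (b k i) = 0)
  (b_var : forall k i, Exp (P k) (fun w => b k i w ^+ 2) = tau k)
  (b_small : forall eps : R, 0 < eps -> \forall k \near \oo, forall i : 'I_k,
     Exp (P k) (fun w => b k i w ^+ 4) <= eps)
  (e4 : forall k i j, finite_fourth (P k) (e k i j))
  (e0 : forall k i j, Exp (P k) (e k i j) = 0)
  (e_var : forall k i j, Exp (P k) (fun w => e k i j w ^+ 2) = v)
  (q0 : 0 <= q) (e_q : forall k i j, Exp (P k) (fun w => e k i j w ^+ 4) <= q)
  (v0 : 0 < v)
  (M_cvg : (fun k => Mstat R (m k) / (nobs (m k))%:R ^+ 3) @ \oo --> lambda).

Definition limit_mean : R := delta ^+ 2 / (2 * v * Num.sqrt lambda).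
Local Notation c := limit_mean.

Let G k := error_pair (P k) k (m k) (b k) (e k).
Let E k := error_sum (P k) k (m k) (b k) (e k).
Let H k := within_error (P k) k (m k) (b k) (e k) v.
Let S k := block_total (P k) k (m k) (b k) (e k).
Let kp : R := kappa N.
Let rt : nat -> R := rate m N.

Let Gm k := pairs_moments (P k) k (m k) (b k) (e k) v q N (mN k) (indep k)
  (e4 k) (e0 k) (e_var k) q0 (e_q k).

Let scaled k (x : R) : R := x / (v * s k).

(** The last clause is the scaling rule behind all estimates: what is at most [y] times n becomes at
    most [y] times [rt k / v]. *)
Let near_scaled : \forall k \near \oo,
  [/\ 0 < s k, s k ^+ 2 = Mstat R (m k), 0 < n k, 0 <= n k / s k <= rt k &
      forall x y : R, 0 <= x -> 0 <= y -> x <= y * n k ->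
        0 <= scaled k x <= y * (rt k / v)].
Proof.
near=> k.
have [s0 sE n0 nsr] : [/\ 0 < s k, s k ^+ 2 = Mstat R (m k), 0 < n k & n k / s k <= rt k].
  by near: k; exact: near_root_M.
have vs0 : 0 < v * s k by rewrite mulr_gt0.
split => //; first by rewrite nsr divr_ge0 ?ltW.
move=> x y x0 y0 xy; rewrite /scaled divr_ge0 ?(ltW vs0)//=.
rewrite ler_pdivrMr// (le_trans xy)//.
have -> : y * (rt k / v) * (v * s k) = y * (rt k * s k).
  by field; rewrite gt_eqF.
by rewrite ler_wpM2l// -ler_pdivrMr.
Unshelve. all: by end_near. Qed.

(** At most n summands of order [rt k ^+ 2] add up to a bounded quantity, because n times the
    squared rate is the constant 1 / kappa. *)
Let near_rate_le (C : nat -> R) : (forall k, 0 <= C k) ->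
  \forall k \near \oo, k%:R * (rt k ^+ 2 * C k) <= kp^-1 * C k.
Proof.
move=> C0; near=> k.
have n0 : 0 < n k.
  have : 1 <= n k by near: k; exact: near_obs_ge mN _.
  by lra.
rewrite mulrA ler_wpM2r// /kp -(rate_sqr m N mN k n0) ler_wpM2r ?sqr_ge0//.
exact: k_le_obs mN k.
Unshelve. all: by end_near. Qed.

Let alpha k (i : 'I_k) : R := scaled k (weight m k i).
Let xi k (i : 'I_k) (w : T k) : R := alpha k i * G k i w.

Let xi_indep k : centered_independent (P k) (xi k).
Proof. exact: pairs_centered (e4 k) (e0 k) (e_var k) q0 (e_q k) (alpha k). Qed.

Let G4 k i : finite_fourth (P k) (G k i). Proof. by have [] := Gm k i. Qed.

Let xi_var k i : Exp (P k) (fun w => xi k i w ^+ 2) =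
  alpha k i ^+ 2 * (v ^+ 2 * (mR k i * (mR k i - 1) / 2)).
Proof.
have -> : (fun w => xi k i w ^+ 2) = fun w => alpha k i ^+ 2 * G k i w ^+ 2.
  by apply/funext => w; rewrite exprMn.
by rewrite ExpZ; [have [_ -> _] := Gm k i|exact: finite_fourth2].
Qed.

(** v^2 cancels, and the sum of variances is the within-treatment part of M divided by M. The mixed
    pairs that are missing number at most n^2 / 2, so the defect is at most the squared rate. *)
Let xi_variance : (fun k => \sum_i Exp (P k) (fun w => xi k i w ^+ 2)) @ \oo --> (1 : R).
Proof.
suff cv : (fun k => \sum_i Exp (P k) (fun w => xi k i w ^+ 2) - 1) @ \oo --> (0 : R).
  have -> : (fun k => \sum_i Exp (P k) (fun w => xi k i w ^+ 2)) =
      fun k => (\sum_i Exp (P k) (fun w => xi k i w ^+ 2) - 1) + 1.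
    by apply/funext => k; rewrite subrK.
  by have := cvgD cv (cvg_cst (1 : R)); rewrite add0r; exact.
apply: (near_le_cvg0 _ (fun k => rt k ^+ 2)); last first.
  have cr := @rate_cvg0 R m N mN.
  by have := cvgM cr cr; rewrite mulr0; exact.
near=> k.
have [s0 sE n0 /andP[ns0 nsr] _] : [/\ 0 < s k, s k ^+ 2 = Mstat R (m k), 0 < n k,
      0 <= n k / s k <= rt k & forall x y : R, 0 <= x -> 0 <= y -> x <= y * n k ->
        0 <= scaled k x <= y * (rt k / v)] by near: k; exact: near_scaled.
have sn0 : s k != 0 by rewrite gt_eqF.
have vn0 : v != 0 by rewrite gt_eqF.
have -> : \sum_i Exp (P k) (fun w => xi k i w ^+ 2) =
    (\sum_i weight m k i ^+ 2 * (mR k i * (mR k i - 1) / 2)) / s k ^+ 2.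
  rewrite mulr_suml; apply: eq_bigr => i _; rewrite xi_var /alpha /scaled.
  by field; rewrite sn0 vn0.
have := @MstatE_weight R m N mN k; rewrite -sE.
set A := \sum_i _; set B := \sum_i _ => ME.
have -> : A / s k ^+ 2 - 1 = - ((n k ^+ 2 - B) / 2 / s k ^+ 2).
  have -> : A = s k ^+ 2 - (n k ^+ 2 - B) / 2 by rewrite ME; ring.
  by field.
have B0 : 0 <= B by apply: sumr_ge0 => i _; exact: sqr_ge0.
have Bn : B <= n k ^+ 2 := @sum_sqr_size_le2 R m k.
have s20 : 0 < s k ^+ 2 by rewrite exprn_gt0.
rewrite normrN ger0_norm; last by rewrite divr_ge0 ?(ltW s20)// divr_ge0//; lra.
apply: (@le_trans _ _ ((n k / s k) ^+ 2)); last by rewrite lerXn2r ?nnegrE// (le_trans ns0).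
by rewrite expr_div_n ler_wpM2r ?invr_ge0 ?(ltW s20)//; lra.
Unshelve. all: by end_near. Qed.

Let g : R := pair_fourth_bound q N.
Let g0 : 0 <= g. Proof. by apply: sumr_ge0 => i _; exact: pair_fourth_ge0. Qed.

(** Each coefficient is at most [rt k / v], so each term is of order [rt k ^+ 3]; summing over the
    treatments consumes two powers and leaves one. [C] collects the moment bounds 1 + g. *)
Let xi_lyapunov : (fun k => \sum_i (Exp (P k) (fun w => `|xi k i w| ^+ 3) +
    Exp (P k) (fun w => xi k i w ^+ 2) * Exp (P k) (fun w => `|xi k i w|))) @ \oo --> (0 : R).
Proof.
pose C : R := ((1 + g) + (1 + g) * (1 + g)) / v ^+ 3.
have C0 : 0 <= C by rewrite divr_ge0 ?exprn_ge0 ?(ltW v0)// addr_ge0 ?mulr_ge0//; have := g0; lra.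
have rt0 k : 0 <= rt k by exact: sqrtr_ge0.
apply: (near_le_cvg0 _ (fun k => (kp^-1 * C) * rt k)); last first.
  by have := cvgM (cvg_cst (kp^-1 * C : R)) (@rate_cvg0 R m N mN); rewrite mulr0; exact.
near=> k.
have [s0 sE n0 _ sc] : [/\ 0 < s k, s k ^+ 2 = Mstat R (m k), 0 < n k,
      0 <= n k / s k <= rt k & forall x y : R, 0 <= x -> 0 <= y -> x <= y * n k ->
        0 <= scaled k x <= y * (rt k / v)] by near: k; exact: near_scaled.
have kr : k%:R * (rt k ^+ 2 * (C * rt k)) <= kp^-1 * (C * rt k).
  by near: k; apply: near_rate_le => k; rewrite mulr_ge0.
have term i : 0 <= Exp (P k) (fun w => `|xi k i w| ^+ 3) +
    Exp (P k) (fun w => xi k i w ^+ 2) * Exp (P k) (fun w => `|xi k i w|) <=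
    rt k ^+ 2 * (C * rt k).
  have /andP[a0 ar] : 0 <= alpha k i <= 1 * (rt k / v).
    by apply: sc => //; [exact: weight_ge0 mN k i|rewrite mul1r; exact: weight_le mN k i].
  rewrite mul1r in ar.
  have -> : (fun w => `|xi k i w| ^+ 3) = fun w => alpha k i ^+ 3 * `|G k i w| ^+ 3.
    by apply/funext => w; rewrite /xi normrM exprMn (ger0_norm a0).
  have -> : (fun w => `|xi k i w|) = fun w => alpha k i * `|G k i w|.
    by apply/funext => w; rewrite /xi normrM (ger0_norm a0).
  have -> : (fun w => xi k i w ^+ 2) = fun w => alpha k i ^+ 2 * G k i w ^+ 2.
    by apply/funext => w; rewrite /xi exprMn.
  rewrite !ExpZ; [|exact/integrableR_norm/finite_fourth1|exact: finite_fourth2|exact: finite_fourth3].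
  have [_ _ Gq] := Gm k i; rewrite -/(G k) -/g in Gq.
  have u1g := le_trans (Exp_abs_le1X4 _ _ (G4 k i)) (lerD (lexx 1) Gq).
  have u2g := le_trans (Exp_sqr_le1X4 _ _ (G4 k i)) (lerD (lexx 1) Gq).
  have u3g := le_trans (Exp_cube_le1X4 _ _ (G4 k i)) (lerD (lexx 1) Gq).
  have u30 : 0 <= Exp (P k) (fun w => `|G k i w| ^+ 3).
    by apply: Exp_ge0 => w; rewrite exprn_ge0.
  have u20 : 0 <= Exp (P k) (fun w => G k i w ^+ 2) by apply: Exp_ge0 => w; exact: sqr_ge0.
  have u10 : 0 <= Exp (P k) (fun w => `|G k i w|) by exact: Exp_ge0.
  move: u1g u2g u3g u10 u20 u30.
  move: (Exp _ (fun w => `|G k i w|)) (Exp _ (fun w => G k i w ^+ 2)).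
  move: (Exp _ (fun w => `|G k i w| ^+ 3)) => u3 u1 u2 u1g u2g u3g u10 u20 u30.
  have -> : alpha k i ^+ 3 * u3 + alpha k i ^+ 2 * u2 * (alpha k i * u1) =
    alpha k i ^+ 3 * (u3 + u2 * u1) by ring.
  have -> : rt k ^+ 2 * (C * rt k) = (rt k / v) ^+ 3 * ((1 + g) + (1 + g) * (1 + g)).
    by rewrite /C; field; rewrite gt_eqF.
  have u0 : 0 <= u3 + u2 * u1 by rewrite addr_ge0// mulr_ge0.
  rewrite mulr_ge0 ?exprn_ge0//= ler_pM ?exprn_ge0//.
    by rewrite lerXn2r ?nnegrE// (le_trans a0).
  by rewrite lerD// ler_pM.
rewrite ger0_norm; last by apply: sumr_ge0 => i _; have /andP[] := term i.
rewrite -[leRHS]mulrA (le_trans _ kr)//.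
have -> : k%:R * (rt k ^+ 2 * (C * rt k)) = \sum_(i < k) rt k ^+ 2 * (C * rt k).
  by rewrite sumr_const card_ord mulr_natl.
by apply: ler_sum => i _; have /andP[] := term i.
Unshelve. all: by end_near. Qed.

Let tau0 k : 0 <= tau k.
Proof. by rewrite divr_ge0 ?sqr_ge0 ?sqrtr_ge0. Qed.

Let tau_cvg0 : tau @ \oo --> (0 : R).
Proof.
have -> : tau = fun k => delta ^+ 2 * Num.sqrt (1 * (n k)^-1).
  by apply/funext => k; rewrite mul1r sqrtrV ?obs_ge0.
have := cvgM (cvg_cst (delta ^+ 2 : R)) (@sqrt_inv_cvg0 R m N mN 1).
by rewrite mulr0; exact.
Qed.

Let A1 k (i : 'I_k) : R := scaled k (weight m k i * (mR k i * (mR k i - 1) / 2)).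
Let A2 k (i : 'I_k) : R := scaled k (weight m k i * (mR k i - 1)).

Let near_A : \forall k \near \oo, forall i : 'I_k,
  0 <= A1 k i <= N%:R * (rt k / v) /\ 0 <= A2 k i <= rt k / v.
Proof.
near=> k; move=> i.
have [_ _ n0 _ sc] : [/\ 0 < s k, s k ^+ 2 = Mstat R (m k), 0 < n k,
      0 <= n k / s k <= rt k & forall x y : R, 0 <= x -> 0 <= y -> x <= y * n k ->
        0 <= scaled k x <= y * (rt k / v)] by near: k; exact: near_scaled.
have mi := @mR_ge2 R m N mN k i; have miN := @mR_leN R m N mN k i.
have mn := @le_mR_obs R m k i.
have w0 := @weight_ge0 R m N mN k i; have wE := @weightM R m N mN k i.
have wE' : weight m k i * (mR k i * (mR k i - 1) / 2) = (n k - mR k i) * (mR k i / 2).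
  by rewrite -wE; ring.
split; last rewrite -[rt k / v]mul1r; apply: sc => //.
- by rewrite wE' mulr_ge0 ?subr_ge0//; lra.
- rewrite wE' mulrC ler_pM ?subr_ge0//; lra.
- by rewrite wE subr_ge0.
- by rewrite wE mul1r; lra.
Unshelve. all: by end_near. Qed.

(** The numerator over [v * s k] equals [c], plus the sum of the [xi], plus [T1], [T2], [T3] and
    [t4]: the fluctuation of the b_i^2, the cross terms, the products between treatments, and the
    deterministic error of the shift. [W5] is W - v. *)
Let T1 k (w : T k) : R := \sum_i A1 k i * (b k i w ^+ 2 - tau k).
Let T2 k (w : T k) : R := \sum_i A2 k i * (b k i w * E k i w).
Let R3 k (w : T k) : R := ((\sum_i S k i w) ^+ 2 - \sum_i S k i w ^+ 2) / 2.
Let T3 k (w : T k) : R := - (v * s k)^-1 * R3 k w.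
Let t4 k : R := tau k * \sum_i A1 k i - c.
Let W5 k (w : T k) : R := (\sum_i H k i w) / n k.

Let sum_cst_le (k : nat) (f : 'I_k -> R) (C : R) : (forall i, f i <= C) ->
  \sum_i f i <= k%:R * C.
Proof.
move=> fC; have -> : k%:R * C = \sum_(i < k) C by rewrite sumr_const card_ord mulr_natl.
by apply: ler_sum => i _; exact: fC.
Qed.

Let kp0 : 0 < kp. Proof. exact: kappa_gt0 m N mN. Qed.

(** The squared coefficients sum to a bounded quantity only, so the second moment is small solely
    through the uniformly small fourth moments [b_small]. *)
Let T1_small : small_in_probability P T1.
Proof.
apply: (small_L2 P T1 (fun k => Exp (P k) (fun w => T1 k w ^+ 2))).
  near=> k.
  have b1 : forall i : 'I_k, Exp (P k) (fun w => b k i w ^+ 4) <= 1.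
    by near: k; apply: b_small.
  by have [] := effects_sqr (P k) k (m k) (b k) (e k) (tau k) 1 (indep k) (b4 k) (b_var k) b1 (A1 k).
apply/cvgrPdist_le => eps e0'.
pose K : R := N%:R ^+ 2 / v ^+ 2.
have K0 : 0 <= K by rewrite divr_ge0 ?sqr_ge0.
pose beta : R := eps * kp / (K + 1).
(* With this [beta] the final bound is eps K / (K + 1) <= eps; the added 1 keeps the denominator
   positive from [0 <= K] alone. *)
have beta0 : 0 < beta by rewrite divr_gt0 ?mulr_gt0//; lra.
near=> k.
have b1 : forall i : 'I_k, Exp (P k) (fun w => b k i w ^+ 4) <= beta.
  by near: k; apply: b_small.
have [_ ET] := effects_sqr (P k) k (m k) (b k) (e k) (tau k) beta (indep k) (b4 k) (b_var k) b1 (A1 k).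
have A1k : forall i : 'I_k, 0 <= A1 k i <= N%:R * (rt k / v) /\ 0 <= A2 k i <= rt k / v.
  by near: k; exact: near_A.
have kr : k%:R * (rt k ^+ 2 * (K * beta)) <= kp^-1 * (K * beta).
  by near: k; apply: near_rate_le => k; rewrite mulr_ge0// ltW.
rewrite sub0r normrN ger0_norm; last by apply: Exp_ge0 => w; exact: sqr_ge0.
apply: (le_trans ET); apply: (@le_trans _ _ (k%:R * (rt k ^+ 2 * (K * beta)))).
  apply: sum_cst_le => i; have [/andP[a0 a1] _] := A1k i.
  have -> : rt k ^+ 2 * (K * beta) = (N%:R * (rt k / v)) ^+ 2 * beta.
    by rewrite /K; field; rewrite gt_eqF.
  by rewrite ler_wpM2r ?(ltW beta0)// lerXn2r ?nnegrE// (le_trans a0).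
rewrite (le_trans kr)// /beta.
have -> : kp^-1 * (K * (eps * kp / (K + 1))) = eps * (K / (K + 1)).
  by field; rewrite !gt_eqF//; lra.
by rewrite ler_piMr ?(ltW e0')// ler_pdivrMr; lra.
Unshelve. all: by end_near. Qed.

(** Here the vanishing factor is the variance [tau k] of the effects, since each b_i multiplies an
    independent error sum. *)
Let T2_small : small_in_probability P T2.
Proof.
apply: (small_L2 P T2 (fun k => kp^-1 * (N%:R / v) * tau k)); last first.
  by have := cvgM (cvg_cst (kp^-1 * (N%:R / v) : R)) tau_cvg0; rewrite mulr0; exact.
near=> k.
have [iT ET] := cross_sqr (P k) k (m k) (b k) (e k) (tau k) v q (indep k) (b4 k) (b0 k)
  (b_var k) (e4 k) (e0 k) (e_var k) q0 (e_q k) (A2 k).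
rewrite /= in ET; split => //; rewrite [leLHS]ET.
have A2k : forall i : 'I_k, 0 <= A1 k i <= N%:R * (rt k / v) /\ 0 <= A2 k i <= rt k / v.
  by near: k; exact: near_A.
have kr : k%:R * (rt k ^+ 2 * (N%:R / v * tau k)) <= kp^-1 * (N%:R / v * tau k).
  by near: k; apply: near_rate_le => k; rewrite mulr_ge0// divr_ge0// ltW.
rewrite -mulrA (le_trans _ kr)//; apply: sum_cst_le => i.
have [_ /andP[a0 a1]] := A2k i; have miN := @mR_leN R m N mN k i.
have -> : rt k ^+ 2 * (N%:R / v * tau k) = (rt k / v) ^+ 2 * (tau k * (N%:R * v)).
  by field; rewrite gt_eqF.
have v0' := ltW v0.
rewrite ler_pM ?sqr_ge0//; first by apply: mulr_ge0 => //; exact: mulr_ge0.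
  by rewrite lerXn2r ?nnegrE// (le_trans a0).
by rewrite ler_wpM2l// ler_wpM2r.
Unshelve. all: by end_near. Qed.

Let T3_small : small_in_probability P T3.
Proof.
apply: (small_L1 P T3 (fun k => (N%:R * tau k + v) * (rt k * v^-1))); last first.
  have c1 : (fun k => N%:R * tau k + v) @ \oo --> (v : R).
    have := cvgD (cvgM (cvg_cst (N%:R : R)) tau_cvg0) (cvg_cst (v : R)).
    by rewrite mulr0 add0r; exact.
  have c2 : (fun k => rt k * v^-1) @ \oo --> (0 : R).
    by have := cvgM (@rate_cvg0 R m N mN) (cvg_cst (v^-1 : R)); rewrite mul0r; exact.
  by have := cvgM c1 c2; rewrite mulr0; exact.
near=> k.
have [s0 _ n0 _ sc] : [/\ 0 < s k, s k ^+ 2 = Mstat R (m k), 0 < n k,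
      0 <= n k / s k <= rt k & forall x y : R, 0 <= x -> 0 <= y -> x <= y * n k ->
        0 <= scaled k x <= y * (rt k / v)] by near: k; exact: near_scaled.
have [iR ER] := between_abs (P k) k (m k) (b k) (e k) (tau k) v q (indep k) (b4 k) (b0 k)
  (b_var k) (e4 k) (e0 k) (e_var k) q0 (e_q k).
split; first exact: integrableRZ.
have vs0 : 0 < v * s k by rewrite mulr_gt0.
have -> : (fun w => `|T3 k w|) = fun w => (v * s k)^-1 * `|R3 k w|.
  have vi0 : 0 <= (v * s k)^-1 by rewrite invr_ge0 ltW.
  by apply/funext => w; rewrite /T3 normrM normrN (ger0_norm vi0).
rewrite ExpZ; last exact: integrableR_norm.
rewrite /= in ER; set B := \sum_i _ in ER.
have B0 : 0 <= B.
  have v0' := ltW v0; apply: sumr_ge0 => i _; apply: addr_ge0; last exact: mulr_ge0.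
  by apply: mulr_ge0 => //; exact: sqr_ge0.
have C0 : 0 <= N%:R * tau k + v by apply: addr_ge0; [exact: mulr_ge0|exact: ltW].
have BC : B <= (N%:R * tau k + v) * n k.
  rewrite obs_sum mulr_sumr; apply: ler_sum => i _.
  have miN := @mR_leN R m N mN k i.
  have -> : mR k i ^+ 2 * tau k + mR k i * v = mR k i * (mR k i * tau k) + mR k i * v by ring.
  have -> : (N%:R * tau k + v) * mR k i = N%:R * (mR k i * tau k) + mR k i * v by ring.
  by rewrite lerD2r ler_wpM2r// mulr_ge0.
have /andP[_] := sc B _ B0 C0 BC.
by apply: le_trans; rewrite /scaled mulrC ler_wpM2r ?invr_ge0 ?(ltW vs0).
Unshelve. all: by end_near. Qed.

Let W5_bound k : 0 < n k -> integrableR (P k) (fun w => W5 k w ^+ 2) /\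
  Exp (P k) (fun w => W5 k w ^+ 2) <= within_bound v q N * (n k)^-1.
Proof.
move=> n0.
have [iH EH] := within_sqr (P k) k (m k) (b k) (e k) v q N (mN k) (indep k)
  (e4 k) (e0 k) (e_var k) q0 (e_q k).
have WE : (fun w => W5 k w ^+ 2) = fun w => (n k ^+ 2)^-1 * (\sum_i H k i w) ^+ 2.
  by apply/funext => w; rewrite /W5 expr_div_n mulrC.
rewrite WE; split; first exact: integrableRZ.
rewrite ExpZ//.
have n2 : 0 < n k ^+ 2 by rewrite exprn_gt0.
have wb0 : 0 <= within_bound v q N.
  rewrite /within_bound mulr_ge0// addr_ge0//.
    by apply: sumr_ge0 => i _; exact: sum_fourth_ge0.
  by rewrite mulr_ge0 ?sqr_ge0// mulr_ge0 ?sqr_ge0.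
rewrite mulrC ler_pdivrMr// (le_trans EH)//.
have -> : within_bound v q N * (n k)^-1 * n k ^+ 2 = n k * within_bound v q N.
  by field; rewrite gt_eqF.
by rewrite ler_wpM2r//; exact: k_le_obs mN k.
Qed.

Let within_inv_cvg0 (C : R) : (fun k => C * (n k)^-1) @ \oo --> (0 : R).
Proof.
by have := cvgM (cvg_cst (C : R)) (@inv_obs_cvg0 R m N mN); rewrite mulr0; exact.
Qed.

Let W5_small : small_in_probability P W5.
Proof.
apply: (small_L2 P W5 (fun k => within_bound v q N * (n k)^-1)); last first.
  exact: within_inv_cvg0.
near=> k; apply: W5_bound.
have : 1 <= n k by near: k; exact: near_obs_ge mN _.
by lra.
Unshelve. all: by end_near. Qed.

Let W5Z_small (r : R) : small_in_probability P (fun k w => r * W5 k w).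
Proof.
apply: (small_L2 P _ (fun k => r ^+ 2 * within_bound v q N * (n k)^-1)); last first.
  exact: within_inv_cvg0.
near=> k.
have n0 : 0 < n k.
  have : 1 <= n k by near: k; exact: near_obs_ge mN _.
  by lra.
have [i5 E5] := W5_bound k n0.
have -> : (fun w => (r * W5 k w) ^+ 2) = fun w => r ^+ 2 * W5 k w ^+ 2.
  by apply/funext => w; rewrite exprMn.
split; first exact: integrableRZ.
by rewrite ExpZ// -mulrA ler_wpM2l ?sqr_ge0.
Unshelve. all: by end_near. Qed.

(** The [A1] sum to (n^2 - B) / 2 over [v * s k], where B is the sum of the squared sizes. The n^2
    part gives [u], which tends to [c]; B is at most N n and contributes only order
    [tau k * rt k]. *)
Let t4_cvg0 : t4 @ \oo --> (0 : R).
Proof.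
have cl := @obs_root_M_cvg R m N lambda mN M_cvg.
pose u k : R := delta ^+ 2 / (2 * v) * (n k ^+ 2 / (Num.sqrt (n k) * s k)).
have sl0 : 0 < Num.sqrt lambda by rewrite sqrtr_gt0 (lambda_gt0 m N lambda mN M_cvg).
have cu : u @ \oo --> c.
  have -> : c = delta ^+ 2 / (2 * v) * (Num.sqrt lambda)^-1.
    by rewrite /limit_mean; field; rewrite !gt_eqF.
  exact: (cvgM (cvg_cst (delta ^+ 2 / (2 * v) : R)) cl).
apply: (near_le_cvg0 _ (fun k => `|u k - c| + tau k * (N%:R * (rt k * v^-1)))); last first.
  have c1 : (fun k => `|u k - c|) @ \oo --> (0 : R).
    have := cvg_norm (cvgB cu (cvg_cst (c : R))).
    by rewrite subrr normr0; exact.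
  have c2 : (fun k => rt k * v^-1) @ \oo --> (0 : R).
    by have := cvgM (@rate_cvg0 R m N mN) (cvg_cst (v^-1 : R)); rewrite mul0r; exact.
  have c3 : (fun k => tau k * (N%:R * (rt k * v^-1))) @ \oo --> (0 : R).
    by have := cvgM tau_cvg0 (cvgM (cvg_cst (N%:R : R)) c2); rewrite mul0r; exact.
  by have := cvgD c1 c3; rewrite addr0; exact.
near=> k.
have [s0 _ n0 _ sc] : [/\ 0 < s k, s k ^+ 2 = Mstat R (m k), 0 < n k,
      0 <= n k / s k <= rt k & forall x y : R, 0 <= x -> 0 <= y -> x <= y * n k ->
        0 <= scaled k x <= y * (rt k / v)] by near: k; exact: near_scaled.
set B := \sum_i mR k i ^+ 2.
have /andP[B0 BN] : 0 <= B <= N%:R * n k by exact: sum_sqr_size_le mN k.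
have /andP[b0' bN] := sc B N%:R B0 (ler0n _ _) BN.
have AE : \sum_i A1 k i = (n k ^+ 2 - B) / 2 / (v * s k).
  rewrite /A1 /scaled -mulr_suml; congr (_ / _).
  have -> : n k ^+ 2 = \sum_i mR k i * n k by rewrite -mulr_suml -obs_sum expr2.
  rewrite /B -sumrB mulr_suml; apply: eq_bigr => i _.
  transitivity (weight m k i * (mR k i - 1) * (mR k i / 2)); first by ring.
  by rewrite (weightM m N mN k i); ring.
have sn0 : s k != 0 by rewrite gt_eqF.
have vn0 : v != 0 by rewrite gt_eqF.
have rn0 : Num.sqrt (n k) != 0 by rewrite gt_eqF// sqrtr_gt0.
have -> : t4 k = (u k - c) - tau k * scaled k B / 2.
  by rewrite /t4 AE /u /scaled /effect_variance; field; rewrite sn0 vn0 rn0.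
rewrite (le_trans (ler_normB _ _))// lerD2l ger0_norm.
  have := ler_wpM2l (tau0 k) bN; have := mulr_ge0 (tau0 k) b0'; lra.
by rewrite divr_ge0// mulr_ge0.
Unshelve. all: by end_near. Qed.

Let mE k i : measurable_fun setT (E k i).
Proof.
have -> : E k i = fun w => \sum_j e k i j w by apply/funext => w; exact: error_sumE.
by apply: measurable_sum.
Qed.

Let mG k i : measurable_fun setT (G k i). Proof. by case: (G4 k i). Qed.

Let mH k i : measurable_fun setT (H k i).
Proof.
apply: measurable_funB => //; apply: measurable_funB; first by apply: measurable_funX; exact: mE.
by apply: measurable_funM => //; exact: mG.
Qed.

Let mS k i : measurable_fun setT (S k i).
Proof. by apply: measurable_funD; [exact: measurable_funM|exact: mE]. Qed.

Let mT1 k : measurable_fun setT (T1 k).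
Proof.
apply: measurable_sum => i; apply: measurable_funM => //; apply: measurable_funB => //.
exact: measurable_funX.
Qed.

Let mT2 k : measurable_fun setT (T2 k).
Proof. by apply: measurable_sum => i; apply: measurable_funM => //; exact: measurable_funM. Qed.

Let mT3 k : measurable_fun setT (T3 k).
Proof.
apply: measurable_funM => //; apply: measurable_funM => //; apply: measurable_funB.
  by apply: measurable_funX; exact: measurable_sum.
by apply: measurable_sum => i; exact: measurable_funX.
Qed.

Let mW5 k : measurable_fun setT (W5 k).
Proof. by apply: measurable_funM => //; exact: measurable_sum. Qed.

(* [J <= x] is linear in the denominator: once [W > 0] it reads
   [numerator - x sqrt(M) (W - v) <= x v sqrt(M)], so no quotient limit is needed. *)
Lemma cvg_cdf_Jrv x :
  {for x, continuous (fun t : R => normal_prob c 1 `]-oo, t]%classic)} ->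
  (fun k => P k [set w | Jrv mu (b k) (e k) w <= x]) @ \oo --> normal_prob c 1 `]-oo, x]%classic.
Proof.
move=> cx.
pose D k (w : T k) : R := T1 k w + T2 k w + T3 k w + t4 k + - (x / v) * W5 k w.
pose Z k (w : T k) : R := c + \sum_i xi k i w.
have mD12 k : measurable_fun setT (fun w => T1 k w + T2 k w) by exact: measurable_funD.
have mD123 k : measurable_fun setT (fun w => T1 k w + T2 k w + T3 k w) by exact: measurable_funD.
have mD1234 k : measurable_fun setT (fun w => T1 k w + T2 k w + T3 k w + t4 k).
  exact: measurable_funD.
have mxW k : measurable_fun setT (fun w => - (x / v) * W5 k w) by exact: measurable_funM.
(* [W5] with threshold [v] plays the role of [H]: [|W5| < v] is the event on which W is surely
   positive. *)
apply: (cvg_cdf_transfer P _ (fun k => Jrv mu (b k) (e k)) Z D W5 x v) => //.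
- by move=> k; apply: measurable_funD => //; apply: measurable_sum => i; exact: measurable_funM.
- by move=> k; exact: measurable_funD.
- apply: small_add => //; apply: small_add => //; last exact: small_cst.
  by apply: small_add => //; exact: small_add.
- near=> k => w Wv.
  have [s0 _ n0 _ _] : [/\ 0 < s k, s k ^+ 2 = Mstat R (m k), 0 < n k,
      0 <= n k / s k <= rt k & forall x y : R, 0 <= x -> 0 <= y -> x <= y * n k ->
        0 <= scaled k x <= y * (rt k / v)] by near: k; exact: near_scaled.
  have k0 : (0 < k)%N by near: k; exact: nbhs_infty_gt.
  have sn0 : s k != 0 by rewrite gt_eqF.
  have vn0 : v != 0 by rewrite gt_eqF.
  have vs0 : 0 < v * s k by rewrite mulr_gt0.
  have W0 : 0 < v + W5 k w by move: Wv; rewrite ltr_norml => /andP[]; lra.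
  have WE := denominatorE (P k) k (m k) (b k) (e k) mu v N (mN k) w k0.
  pose X1 := \sum_i weight m k i * (mR k i * (mR k i - 1) / 2 * b k i w ^+ 2).
  pose X2 := \sum_i weight m k i * (mR k i - 1) * (b k i w * E k i w).
  pose X3 := \sum_i weight m k i * G k i w.
  have NE : 'C(nobs (m k), 2)%:R * @Bstat R k (m k) (fun i j => Yobs mu (b k) (e k) j w) =
      X1 + X2 + X3 - R3 k w := numeratorE (P k) k (m k) (b k) (e k) mu N (mN k) w.
  have T1E : T1 k w = X1 / (v * s k) - tau k * \sum_i A1 k i.
    rewrite /T1 mulr_sumr mulr_suml -sumrB; apply: eq_bigr => i _.
    by rewrite /A1 /scaled; ring.
  have T2E : T2 k w = X2 / (v * s k).
    by rewrite /T2 mulr_suml; apply: eq_bigr => i _; rewrite /A2 /scaled; ring.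
  have ZE : Z k w = c + X3 / (v * s k).
    by rewrite /Z mulr_suml; congr (_ + _); apply: eq_bigr => i _; rewrite /xi /alpha /scaled; ring.
  have ZD : Z k w + D k w = (X1 + X2 + X3 - R3 k w - x * s k * W5 k w) / (v * s k).
    by rewrite ZE /D T1E T2E /T3 /t4; field; rewrite sn0 vn0.
  rewrite /Jrv /Jstat WE NE -/(W5 k w) -/(s k).
  rewrite ZD !ler_pdivrMr ?mulr_gt0// [RHS]lerBlDr.
  by congr (_ <= _); ring.
- move=> a a' eps; apply: (triangular_clt P _ xi c xi_indep _ xi_variance xi_lyapunov) => k i.
  exact: finite_fourth3 (finite_fourthZ _ _ _ (G4 k i)).
Unshelve. all: by end_near. Qed.

End local_alternatives.

Theorem mainTheorem2 (R : realType)
    (* for each number k of treatments: treatment sizes and probability space *)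
    (m : forall k : nat, 'I_k -> nat)
    (d : nat -> measure_display) (T : forall k, measurableType (d k))
    (P : forall k, probability (T k) R)
    (mu : R)
    (b : forall k, 'I_k -> {RV (P k) >-> R})
    (e : forall k (i : 'I_k), 'I_(m k i) -> {RV (P k) >-> R})
    (sigma_e delta lambda : R) (N : nat)
    (size_bounds : forall k (i : 'I_k), (2 <= m k i <= N)%N)
    (independent : forall k,
      mutually_independent (P k) (effects_and_errors (b k) (e k)))
    (b_identical : forall k (i i' : 'I_k), same_distribution (P k) (P k) (b k i) (b k i'))
    (b_mean : forall k (i : 'I_k), ('E_(P k)[b k i] = 0)%E)
    (b_variance : forall k (i : 'I_k),
      ('V_(P k)[b k i] = (delta ^+ 2 / Num.sqrt (nobs (m k))%:R)%:E)%E)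
    (b_fourth_moment : forall k (i : 'I_k),
      ('E_(P k)[fun w => (b k i w ^+ 4)%R] < +oo)%E)
    (* the laws of the b_i form a triangular array, so finiteness for each k
       does not suffice: their fourth moments vanish with their variances *)
    (b_fourth_moment_cvg : forall eps : R, 0 < eps ->
      \forall k \near \oo, forall i : 'I_k,
        ('E_(P k)[fun w => (b k i w ^+ 4)%R] <= eps%:E)%E)
    (e_identical : forall k (i : 'I_k) (j : 'I_(m k i))
        k' (i' : 'I_k') (j' : 'I_(m k' i')),
      same_distribution (P k) (P k') (e k i j) (e k' i' j'))
    (e_mean : forall k (i : 'I_k) (j : 'I_(m k i)), ('E_(P k)[e k i j] = 0)%E)
    (sigma_e_gt0 : 0 < sigma_e)
    (e_variance : forall k (i : 'I_k) (j : 'I_(m k i)),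
      ('V_(P k)[e k i j] = (sigma_e ^+ 2)%:E)%E)
    (e_fourth_moment : forall k (i : 'I_k) (j : 'I_(m k i)),
      ('E_(P k)[fun w => (e k i j w ^+ 4)%R] < +oo)%E)
    (M_cvg : (fun k => Mstat R (m k) / (nobs (m k))%:R ^+ 3) @ \oo --> lambda) :
  cvg_in_distribution P (fun k => Jrv mu (b k) (e k))
    (normal_prob (delta ^+ 2 / (2 * sigma_e ^+ 2 * Num.sqrt lambda)) 1).
Proof.
(* All errors share one law, also across [k], so a single error of the one-treatment design supplies
   the common fourth moment; its index 0 exists because sizes are at least 2. *)
pose q : R := Exp (P 1) (fun w => e 1%N ord0 (Ordinal (ltnW (andP (size_bounds 1%N ord0)).1)) w ^+ 4).
have m4 k (X : {RV (P k) >-> R}) : ('E_(P k)[fun w => (X w ^+ 4)%R] < +oo)%E ->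
    finite_fourth (P k) X.
  move=> X4; split => //; apply: integrableR_expectation X4 => [|w].
    exact: measurable_funX.
  exact: exprn_even_ge0.
have b4 k i := m4 k _ (b_fourth_moment k i).
have e4 k i j := m4 k _ (e_fourth_moment k i j).
have mean k (X : {RV (P k) >-> R}) : finite_fourth (P k) X -> ('E_(P k)[X] = 0)%E ->
    Exp (P k) X = 0.
  by move=> X4; rewrite Exp_expectation; [move=> []|exact: finite_fourth1].
have var k (X : {RV (P k) >-> R}) (a : R) : finite_fourth (P k) X ->
    ('E_(P k)[X] = 0)%E -> ('V_(P k)[X] = a%:E)%E -> Exp (P k) (fun w => X w ^+ 2) = a.
  by move=> X4 X0; rewrite variance_Exp//; [move=> []|exact: finite_fourth2].
have v0 : 0 < sigma_e ^+ 2 by rewrite exprn_gt0.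
have q0 : 0 <= q by apply: Exp_ge0 => w; exact: exprn_even_ge0.
have e_q k i j : Exp (P k) (fun w => e k i j w ^+ 4) <= q.
  rewrite le_eqVlt; apply/orP; left; apply/eqP.
  apply: (same_distribution_Exp _ _ (fun x => x ^+ 4)) => //.
  by move=> x; exact: exprn_even_ge0.
have b_small (eps : R) : 0 < eps -> \forall k \near \oo, forall i : 'I_k,
    Exp (P k) (fun w => b k i w ^+ 4) <= eps.
  move=> e0; near=> k => i; rewrite -lee_fin -Exp_expectation; last by case: (b4 k i).
  by move: i; near: k; exact: b_fourth_moment_cvg.
move=> x cx.
have := cvg_cdf_Jrv m d T P mu b e delta lambda (sigma_e ^+ 2) q N size_bounds
  independent b4 (fun k i => mean k _ (b4 k i) (b_mean k i))
  (fun k i => var k _ _ (b4 k i) (b_mean k i) (b_variance k i)) b_small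
  e4 (fun k i j => mean k _ (e4 k i j) (e_mean k i j))
  (fun k i j => var k _ _ (e4 k i j) (e_mean k i j) (e_variance k i j))
  q0 e_q v0 M_cvg x cx.
move=> H; exact: H.
Unshelve. all: by end_near. Qed.
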